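(* Let $r\ge 1$ and $\alpha\in(0,1]$ (both allowed to depend on $n$), and put $\mu=\mu(r,\alpha)=\frac{r+1-\log_2(1+\alpha)}{2-\log_2(1+\alpha)}$. (i) (Lower bound.) There is an absolute constant $K>0$ such that for every $\delta\in(0,1)$ and all sufficiently large $n$ (depending on $\delta$): if $r\le n^{\delta}$ and $\alpha^{-1}\le n^{\delta}$, then $\mathrm{tr}(n,n^r,\alpha n)\ge n^{\mu(1-K\delta)}$. Moreover, for every constant $r\ge1$ and every constant $c>0$ there is a constant $K'=K'(r,c)$ such that if $\alpha^{-1}\le(\log n)^{c}$ then $\mathrm{tr}(n,n^r,\alpha n)\ge n^{\mu}/(\log n)^{K'}$ for all sufficiently large $n$. (ii) (Upper bound.) There is an absolute constant $K''$ such that for all sufficiently large $n$, all $0<\alpha\le1$ and all $1\le r\le \sqrt n/\log_2 n$, we have $\mathrm{tr}(n,n^r,\alpha n)\le K'' n^{\mu}$. Consequently, if $r,\alpha^{-1}\le n^{o(1)}$ then $\mathrm{tr}(n,n^r,\alpha n)=n^{\mu(1+o(1))}$, and if $r=O(1)$ and $\alpha^{-1}\le(\log n)^{O(1)}$ then $\mathrm{tr}(n,n^r,\alpha n)=n^{\mu}(\log n)^{\Theta(1)}$ (i.e. $\tilde\Theta(n^\mu)$).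
   Context: A hypergraph (set system) on $[n]$ is a family $\mathcal F\subseteq 2^{[n]}$; its elements are edges. For $I\subseteq[n]$, the trace of $\mathcal F$ on $I$ is $\mathcal F_I=\{e\cap I: e\in\mathcal F\}$. For integers $n\ge k$ and $0\le m\le 2^n$, $\mathrm{tr}(n,m,k)=\min_{\mathcal F\subseteq 2^{[n]},|\mathcal F|=m}\ \max_{I\subseteq[n],|I|=k}|\mathcal F_I|$. Logarithms are base 2. Non-integer quantities such as $n^r$ and $\alpha n$ are rounded to integers. *)

(* Defs.v *)
From mathcomp Require Import all_boot.
From Stdlib Require Import Reals ZArith.

Set Implicit Arguments.
Unset Strict Implicit.
Unset Printing Implicit Defensive.

Definition trace_card (n : nat) (F : {set {set 'I_n}}) (I : {set 'I_n}) : nat :=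
  #|[set e :&: I | e in F]|.

(* max over I with |I| = k of |F_I|  (0 if there is no such I, i.e. k > n) *)
Definition max_trace (n : nat) (F : {set {set 'I_n}}) (k : nat) : nat :=
  \max_(I : {set 'I_n} | #|I| == k) trace_card F I.

(* tr(n,m,k) = min over F with |F| = m of max_trace F k.
   The seed 2^n of the min is >= every trace size, so it never affects the
   value when some F with |F| = m exists (i.e. m <= 2^n). *)
Definition tr (n m k : nat) : nat :=
  \big[minn/2 ^ n]_(F : {set {set 'I_n}} | #|F| == m) max_trace F k.

Open Scope R_scope.

Definition log2 (x : R) : R := ln x / ln 2.

Definition mu (r a : R) : R :=
  (r + 1 - log2 (1 + a)) / (2 - log2 (1 + a)).

Definition rnd (x : R) : nat := Z.to_nat (Int_part x).

Close Scope R_scope.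

(* Main.v *)
(* Lower bound. After down-compression F is a downset, its trace on I counts
   the edges inside I, and averaging over the k-sets I shows that the maximal
   trace t is at least about w(F) = sum_(e in F) alpha^|e|. For a downset G the
   product inequality gives w(G) >= |G|^L with L = log2 (1 + alpha). Removing
   the edges inside a maximal dense vertex set leaves a family in which every
   small vertex set S spans O(t |S| / k) edges. Every edge e contains a set A of
   bounded size such that e \ A lies in a set of at most k/2 vertices determined
   by A (unless F has about n^r edges of size about r, which already makes w(F)
   large). Inside that small set the link of A is degenerate: in a suitable
   elimination ordering each vertex is the first one of at most
   D = O(t log(m) / k) members, and applying the product inequality to these
   small pieces gives w(F) >= |F| D^(L-1) up to lower order factors. With
   t >= w(F) this is solved for t.

   Upper bound. Take n (2 / (1 + alpha))^d random transversals of d disjoint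
   classes of vertices, where 2^d is about n^(mu - 1), and all their subsets of
   size at least d/2. Two transversals rarely agree in d/2 places, so there are
   enough edges, and an exponential moment estimate with a union bound over I
   shows that every trace is O(n 2^d). *)
Require Import Defs.
From Stdlib Require Import Reals.
From Stdlib Require Import Lra Lia Psatz ZArith.
From mathcomp Require all_boot all_order all_algebra zify Rstruct.

(** * Real-variable estimates *)

Module RealEstimates.
Local Open Scope R_scope.

Lemma ln2_gt0 : 0 < ln 2.
Proof. rewrite <- ln_1; apply ln_increasing; lra. Qed.

Lemma Rpower_gt0 x y : 0 < Rpower x y.
Proof. apply exp_pos. Qed.

Lemma ln_le_mono x y : 0 < x -> x <= y -> ln x <= ln y.
Proof. intros x0 [xy | ->]; [left; now apply ln_increasing | lra]. Qed.

Lemma exp_le_mono x y : x <= y -> exp x <= exp y.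
Proof. intros [xy | ->]; [left; now apply exp_increasing | lra]. Qed.

Lemma Rpower2_log2 x : 0 < x -> Rpower 2 (log2 x) = x.
Proof.
intros x0; pose proof ln2_gt0; unfold Rpower, log2.
replace (ln x / ln 2 * ln 2) with (ln x) by (field; lra); now apply exp_ln.
Qed.

Lemma log2_1p_bounds a : 0 < a <= 1 -> 0 < log2 (1 + a) <= 1.
Proof.
intros [a0 a1]; pose proof ln2_gt0 as l2; unfold log2; split.
  apply Rdiv_lt_0_compat; [rewrite <- ln_1; apply ln_increasing; lra | assumption].
apply (Rmult_le_reg_r (ln 2)); [assumption |].
replace (ln (1 + a) / ln 2 * ln 2) with (ln (1 + a)) by (field; lra).
rewrite Rmult_1_l; apply ln_le_mono; lra.
Qed.

Lemma Rpower_le_l_neg c x y : c <= 0 -> 0 < x <= y -> Rpower y c <= Rpower x c.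
Proof.
intros c0 [x0 xy].
replace c with (- - c) by ring; rewrite (Rpower_Ropp y), (Rpower_Ropp x).
apply Rinv_le_contravar; [apply Rpower_gt0 | apply Rle_Rpower_l; lra].
Qed.

(** Since [exp (- x / 2) >= 1 - x / 2], it suffices that [(1 + x) (1 - x / 2) >= 1] on [0, 1]. It
    lets a product of factors [1 + x_i] serve as an exponential moment. *)
Lemma exp_half_le x : 0 <= x <= 1 -> exp (x / 2) <= 1 + x.
Proof.
intros x01; pose proof (exp_ineq1_le (- (x / 2))) as h; pose proof (exp_pos (x / 2)).
rewrite exp_Ropp in h.
assert (exp (x / 2) * (1 + - (x / 2)) <= 1).
{ apply Rle_trans with (exp (x / 2) * / exp (x / 2)).
    apply Rmult_le_compat_l; lra.
  rewrite Rinv_r; lra. }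
nra.
Qed.

(* The map [u -> (1 + u)^L - u^L] is nonincreasing. *)
Lemma Rpower_1p_le L u : 0 < L <= 1 -> 1 <= u ->
  Rpower (u + 1) L <= Rpower u L + (Rpower 2 L - 1).
Proof.
intros [L0 L1] [u1 | <-].
2:{ replace (1 + 1) with 2 by ring; unfold Rpower at 2; rewrite ln_1, Rmult_0_r, exp_0; lra. }
set (f := fun x => Rpower (x + 1) L - Rpower x L).
set (f' := fun x => L * Rpower (x + 1) (L - 1) - L * Rpower x (L - 1)).
assert (D : forall c, 1 <= c <= u -> derivable_pt_lim f c (f' c)).
{ intros c [c1 _]; apply derivable_pt_lim_minus.
  2: apply derivable_pt_lim_power; lra.
  replace (L * Rpower (c + 1) (L - 1)) with (L * Rpower (c + 1) (L - 1) * (1 + 0)) by ring.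
  apply (derivable_pt_lim_comp (fun x => x + 1) (fun x => Rpower x L)).
    apply derivable_pt_lim_plus; [apply derivable_pt_lim_id | apply derivable_pt_lim_const].
  apply derivable_pt_lim_power; lra. }
destruct (MVT_cor2 f f' 1 u u1 D) as [c [E [c1 c2]]].
assert (H : f' c <= 0).
{ unfold f'; assert (Rpower (c + 1) (L - 1) <= Rpower c (L - 1)) by (apply Rpower_le_l_neg; lra).
  nra. }
assert (H1 : f u - f 1 <= 0) by (rewrite E; nra).
unfold f in H1; replace (1 + 1) with 2 in H1 by ring.
assert (E1 : Rpower 1 L = 1) by (unfold Rpower; rewrite ln_1, Rmult_0_r; apply exp_0).
rewrite E1 in H1; lra.
Qed.

(** Dividing by [y ^ L], where [L = log2 (1 + a)], reduces this to [Rpower_1p_le] at [u = x / y],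
    because [2 ^ L - 1 = a]. This is the inductive step of the product inequality for downsets. *)
Lemma Rpower_add_le a x y : 0 < a <= 1 -> 0 < y <= x ->
  Rpower (x + y) (log2 (1 + a)) <= Rpower x (log2 (1 + a)) + a * Rpower y (log2 (1 + a)).
Proof.
intros Ha [y0 yx]; pose proof (log2_1p_bounds a Ha) as HL; set (L := log2 (1 + a)) in *.
assert (u1 : 1 <= x / y).
{ apply (Rmult_le_reg_r y); [assumption |].
  replace (x / y * y) with x by (field; lra); lra. }
pose proof (Rpower_1p_le L (x / y) HL u1) as H.
unfold L in H at 3; rewrite Rpower2_log2 in H by lra; fold L in H.
replace (x + y) with ((x / y + 1) * y) by (field; lra).
replace (Rpower x L) with (Rpower (x / y * y) L) by (f_equal; field; lra).
rewrite <- !Rpower_mult_distr by lra.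
pose proof (Rpower_gt0 y L); nra.
Qed.

Lemma mu_eq r a : 0 < a <= 1 -> mu r a = 1 + (r - 1) / (2 - log2 (1 + a)).
Proof. intros Ha; pose proof (log2_1p_bounds a Ha); unfold mu; field; lra. Qed.

Lemma mu_bounds r a : 1 <= r -> 0 < a <= 1 -> (r + 1) / 2 <= mu r a <= r.
Proof.
intros r1 Ha; pose proof (log2_1p_bounds a Ha) as HL; rewrite mu_eq by assumption.
set (L := log2 (1 + a)) in *.
assert (H : / 2 <= / (2 - L) <= 1).
{ split; [apply Rinv_le_contravar; lra | rewrite <- Rinv_1; apply Rinv_le_contravar; lra]. }
unfold Rdiv; nra.
Qed.

Lemma pow_ge_self x n : 1 <= x -> (1 <= n)%nat -> x <= x ^ n.
Proof.
intros x1 n1; replace x with (x ^ 1) at 1 by ring; now apply Rle_pow.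
Qed.

(* The second alternative yields [N^r <= W (t/N)^(1-L) t] with
   [W = 64 J^3 (s/a)^(J+1)], which is solved for [t]. *)
Lemma lower_bound_algebra (N k m t a r s X : R) (J : nat) :
  1 <= N -> 0 < a <= 1 -> 1 <= r <= INR J -> 1 <= s -> 0 < t ->
  a * N / 2 <= k -> a * N / 8 <= X -> Rpower N r / 2 <= m ->
  (a * X) ^ J <= 2 * INR J ^ J * t \/
  a ^ J * Rpower (Rmax 1 (4 * t * INR J * s / k)) (log2 (1 + a) - 1) * (m - t)
    <= INR J * (INR J * s ^ J) * (2 * t) ->
  Rpower N (mu r a) <= t * (64 * s * INR J / a ^ 2) ^ (J + 2).
Proof.
intros N1 Ha [r1 rJ] s1 t0 Hk HX Hm H.
pose proof (log2_1p_bounds a Ha) as HL; pose proof (mu_bounds r a r1 Ha) as [Hmu1 Hmu2].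
pose proof Ha as [a0 a1].
set (L := log2 (1 + a)) in *; set (j := INR J) in *.
assert (j1 : 1 <= j) by lra.
assert (J1 : (1 <= J)%nat) by (apply INR_le; simpl; fold j; lra).
assert (ia : 1 <= / a) by (rewrite <- Rinv_1; apply Rinv_le_contravar; lra).
set (Q := 64 * s * j / a ^ 2).
assert (EQ : Q = 64 * (s * / a) * (j * / a)) by (unfold Q; field; lra).
assert (sa : 1 <= s * / a) by nra.
assert (ja : 1 <= j * / a) by nra.
assert (ss : s <= s * / a) by nra.
assert (sj : 1 <= s * / a * j) by nra.
assert (Qsj : 64 * (s * / a * j) <= Q) by (rewrite EQ; nra).
assert (Q64 : 64 <= Q) by nra.
assert (QJ1 : 1 <= Q ^ J) by (apply pow_R1_Rle; lra).
assert (QJ2 : Q ^ (J + 2) = Q ^ J * (Q * Q)) by (rewrite pow_add; simpl; ring).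
assert (QQ : 4096 <= Q * Q) by nra.
assert (Q2 : 4096 <= Q ^ (J + 2)) by (rewrite QJ2; nra).
assert (Nmu : Rpower N (mu r a) <= Rpower N r) by (apply Rle_Rpower; lra).
assert (Nmu0 := Rpower_gt0 N (mu r a)).
(* First alternative: [X >= a N / 8], so [N ^ J], and hence [N ^ r], is at most
   [2 t (8 J / a ^ 2) ^ J]. *)
destruct H as [H | H].
{ assert (h1 : Rpower N r <= N ^ J).
  { rewrite <- Rpower_pow by lra; apply Rle_Rpower; [lra | exact rJ]. }
  assert (h2 : (a * (a * N / 8)) ^ J <= 2 * j ^ J * t).
  { refine (Rle_trans _ _ _ _ H); apply pow_incr; split; [|nra].
    apply Rmult_le_pos; [lra|]. apply Rmult_le_pos; [nra|lra]. }
  replace (a * (a * N / 8)) with (N * (a ^ 2 / 8)) in h2 by (field).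
  rewrite Rpow_mult_distr in h2.
  assert (p1 : 0 < (a ^ 2 / 8) ^ J).
  { apply pow_lt; unfold Rdiv; apply Rmult_lt_0_compat; [apply pow_lt; lra | lra]. }
  assert (h3 : N ^ J <= 2 * t * (j ^ J * (/ (a ^ 2 / 8)) ^ J)).
  { apply (Rmult_le_reg_r ((a ^ 2 / 8) ^ J)); [assumption |].
    replace (2 * t * (j ^ J * (/ (a ^ 2 / 8)) ^ J) * (a ^ 2 / 8) ^ J) with
      (2 * t * (j ^ J * (/ (a ^ 2 / 8) * (a ^ 2 / 8)) ^ J)) by (rewrite Rpow_mult_distr; ring).
    rewrite Rinv_l by (apply Rgt_not_eq; unfold Rdiv; apply Rmult_lt_0_compat; [apply pow_lt; lra | lra]).
    rewrite pow1; lra. }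
  rewrite <- Rpow_mult_distr in h3.
  assert (h4 : (j * / (a ^ 2 / 8)) ^ J <= Q ^ J).
  { apply pow_incr; split.
      apply Rmult_le_pos; [lra | left; apply Rinv_0_lt_compat; unfold Rdiv; apply Rmult_lt_0_compat; [apply pow_lt; lra | lra]].
    replace (j * / (a ^ 2 / 8)) with (8 * (/ a * (j * / a))) by (field; lra).
    rewrite EQ; nra. }
  rewrite QJ2.
  assert (2 * t * (j * / (a ^ 2 / 8)) ^ J <= 2 * t * Q ^ J) by (apply Rmult_le_compat_l; lra).
  assert (2 * t * Q ^ J <= t * (Q ^ J * (Q * Q))) by (assert (0 < t * Q ^ J) by nra; nra).
  lra. }
(* If [t >= m / 2], then [t] already has the order of [N ^ r], which is at least [N ^ mu]. Otherwise
   [m - t] is at least [N ^ r / 4]. *)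
destruct (Rle_dec (m / 2) t) as [mt | mt].
{ assert (4 * t <= t * Q ^ (J + 2)) by nra; lra. }
apply Rnot_le_lt in mt.
assert (Nr0 := Rpower_gt0 N r).
set (D := Rmax 1 (4 * t * j * s / k)) in *.
assert (D1 : 1 <= D) by apply Rmax_l.
assert (aJ0 : 0 < a ^ J) by (apply pow_lt; lra).
assert (sJ0 : 1 <= s ^ J) by (apply pow_R1_Rle; lra).
set (W := 8 * j ^ 2 * (s * / a) ^ J).
assert (W0 : 0 < W).
{ unfold W; apply Rmult_lt_0_compat; [nra | apply pow_lt; lra]. }
assert (h1 : Rpower N r <= W * t * Rpower D (1 - L)).
{ assert (g1 : a ^ J * Rpower D (L - 1) * (Rpower N r / 4) <= j * (j * s ^ J) * (2 * t)).
  { refine (Rle_trans _ _ _ _ H); apply Rmult_le_compat_l; [|lra].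
    apply Rmult_le_pos; [lra | left; apply Rpower_gt0]. }
  assert (g2 : Rpower D (L - 1) * Rpower D (1 - L) = 1).
  { rewrite <- Rpower_plus; replace (L - 1 + (1 - L)) with 0 by ring; apply Rpower_O; lra. }
  assert (g3 : a ^ J * (/ a) ^ J = 1).
  { rewrite <- Rpow_mult_distr, Rinv_r by lra; apply pow1. }
  assert (p3 : 0 < (/ a) ^ J) by (apply pow_lt; lra).
  assert (p4 := Rpower_gt0 D (1 - L)).
  unfold W; rewrite Rpow_mult_distr.
  replace (Rpower N r) with
    (4 * ((/ a) ^ J * Rpower D (1 - L)) * (a ^ J * Rpower D (L - 1) * (Rpower N r / 4))).
  2:{ replace (4 * ((/ a) ^ J * Rpower D (1 - L)) * (a ^ J * Rpower D (L - 1) * (Rpower N r / 4)))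
      with ((a ^ J * (/ a) ^ J) * (Rpower D (L - 1) * Rpower D (1 - L)) * Rpower N r) by field.
      rewrite g2, g3; ring. }
  replace (8 * j ^ 2 * (s ^ J * (/ a) ^ J) * t * Rpower D (1 - L)) with
    (4 * ((/ a) ^ J * Rpower D (1 - L)) * (j * (j * s ^ J) * (2 * t))) by ring.
  apply Rmult_le_compat_l; [|assumption].
  assert (0 < (/ a) ^ J * Rpower D (1 - L)) by now apply Rmult_lt_0_compat.
  lra. }
assert (hW : W * (8 * s * j * / a) <= Q ^ (J + 2)).
{ unfold W; rewrite QJ2.
  assert (q1 : j * (s * / a) ^ J <= Q ^ J).
  { apply Rle_trans with (j ^ J * (s * / a) ^ J).
      apply Rmult_le_compat_r; [left; apply pow_lt; lra | now apply pow_ge_self].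
    rewrite <- Rpow_mult_distr; apply pow_incr; split; nra. }
  replace (8 * j ^ 2 * (s * / a) ^ J * (8 * s * j * / a)) with
    ((j * (s * / a) ^ J) * (64 * (s * / a * j) * j)) by ring.
  apply Rmult_le_compat.
  - apply Rmult_le_pos; [lra | left; apply pow_lt; lra].
  - nra.
  - assumption.
  - apply Rmult_le_compat; nra. }
assert (E1 : 1 <= 8 * s * j * / a) by nra.
destruct (Rle_dec (4 * t * j * s / k) 1) as [D1' | D1'].
{ assert (ED : D = 1) by (unfold D; apply Rmax_left; lra).
  rewrite ED in h1; unfold Rpower at 2 in h1; rewrite ln_1, Rmult_0_r, exp_0, Rmult_1_r in h1.
  assert (W <= Q ^ (J + 2)) by nra.
  nra. }
apply Rnot_le_lt in D1'.
assert (ED : D = 4 * t * j * s / k) by (unfold D; apply Rmax_right; lra).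
set (E := 8 * s * j * / a) in *.
assert (k0 : 0 < k) by nra.
assert (x0 : 0 < t / N) by (apply Rdiv_lt_0_compat; lra).
assert (hD : D <= t / N * E).
{ rewrite ED; apply (Rmult_le_reg_r k); [assumption |].
  replace (4 * t * j * s / k * k) with (4 * t * j * s) by (field; lra).
  apply Rle_trans with (t / N * E * (a * N / 2)).
    right; unfold E; field; lra.
  apply Rmult_le_compat_l; [nra | assumption]. }
assert (h2 : Rpower D (1 - L) <= Rpower (t / N) (1 - L) * E).
{ apply Rle_trans with (Rpower (t / N * E) (1 - L)); [apply Rle_Rpower_l; lra |].
  rewrite <- Rpower_mult_distr by lra.
  apply Rmult_le_compat_l; [left; apply Rpower_gt0 |].
  rewrite <- (Rpower_1 E) at 2 by lra; apply Rle_Rpower; lra. }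
(* [V] collects all lower order factors: it is [64 j ^ 3 (s / a) ^ (J + 1)]. *)
set (V := W * E) in *.
assert (V0 : 0 < V) by (unfold V; nra).
assert (h3 : Rpower N (r - 1) <= V * Rpower (t / N) (2 - L)).
{ apply (Rmult_le_reg_r N); [lra |].
  replace (Rpower N (r - 1) * N) with (Rpower N r).
  2:{ rewrite <- (Rpower_1 N) at 3 by lra; rewrite <- Rpower_plus; f_equal; ring. }
  replace (2 - L) with (1 - L + 1) by ring; rewrite Rpower_plus, Rpower_1 by lra.
  replace (V * (Rpower (t / N) (1 - L) * (t / N)) * N) with (W * t * (Rpower (t / N) (1 - L) * E))
    by (unfold V; field; lra).
  apply Rle_trans with (1 := h1); apply Rmult_le_compat_l; [nra | assumption]. }
apply Rle_trans with (t * V); [|apply Rmult_le_compat_l; lra].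
(* If [t V < N ^ mu = N N ^ q], then raising [(t / N) V < N ^ q] to the power [2 - L] and using
   [V <= V ^ (2 - L)] contradicts [h3]. *)
destruct (Rle_dec (Rpower N (mu r a)) (t * V)) as [ok | bad]; [assumption | exfalso].
apply Rnot_le_lt in bad.
assert (V1 : 1 <= V).
{ unfold V, W; assert (1 <= (s * / a) ^ J) by (apply pow_R1_Rle; lra).
  assert (1 <= j ^ 2) by nra. assert (1 <= j ^ 2 * (s * / a) ^ J) by nra. nra. }
set (q := (r - 1) / (2 - L)).
assert (Eq : mu r a = 1 + q) by (unfold q, L; now apply mu_eq).
rewrite Eq, Rpower_plus, Rpower_1 in bad by lra.
assert (b1 : t / N * V < Rpower N q).
{ apply (Rmult_lt_reg_r N); [lra |].
  replace (t / N * V * N) with (t * V) by (field; lra); lra. }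
assert (b2 : Rpower (t / N * V) (2 - L) < Rpower (Rpower N q) (2 - L)).
{ apply Rlt_Rpower_l; [lra | split; [nra | assumption]]. }
rewrite Rpower_mult, <- Rpower_mult_distr in b2 by lra.
replace (q * (2 - L)) with (r - 1) in b2 by (unfold q; field; lra).
assert (b3 : V <= Rpower V (2 - L)).
{ rewrite <- (Rpower_1 V) at 1 by lra; apply Rle_Rpower; lra. }
pose proof (Rpower_gt0 (t / N) (2 - L)); nra.
Qed.

Lemma rnd_bounds x : 0 <= x -> x - 1 < INR (rnd x) <= x.
Proof.
intros x0; destruct (base_Int_part x) as [h1 h2].
assert (0 <= Int_part x)%Z.
{ apply Z.lt_succ_r, lt_IZR; rewrite succ_IZR; lra. }
unfold rnd; rewrite INR_IZR_INZ, Z2Nat.id by assumption; lra.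
Qed.

Lemma bernoulli_sub x j : 0 <= x <= 1 -> 1 - INR j * x <= (1 - x) ^ j.
Proof.
intros x01; induction j as [|j IH]; [simpl; lra |].
rewrite S_INR; simpl pow; pose proof (pos_INR j).
assert (0 <= (1 - x) ^ j) by (apply pow_le; lra). nra.
Qed.

(** A relative error [y / a] of at most [1 / (2 s)] costs a factor of at most 2 in every power up to
    [s], by Bernoulli's inequality. *)
Lemma pow_le_double a b y (j s : nat) : 0 < a -> 0 <= y -> a - y <= b ->
  2 * INR s * y <= a -> (1 <= s)%nat -> (j <= s)%nat -> a ^ j <= 2 * b ^ j.
Proof.
intros a0 y0 ab sy s1 js.
assert (1 <= INR s) by (change 1 with (INR 1); now apply le_INR).
pose proof (le_INR _ _ js); pose proof (pos_INR j).
assert (E : y = y / a * a) by (field; lra).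
assert (x0 : 0 <= y / a) by (apply Rmult_le_pos; [lra | left; now apply Rinv_0_lt_compat]).
set (x := y / a) in *.
assert (hx : 2 * INR s * x <= 1) by (apply (Rmult_le_reg_r a); [assumption | nra]).
assert (B : 1 - INR j * x <= (1 - x) ^ j) by (apply bernoulli_sub; nra).
assert (hp : (a * (1 - x)) ^ j <= b ^ j) by (apply pow_incr; split; nra).
rewrite Rpow_mult_distr in hp.
assert (0 < a ^ j) by now apply pow_lt.
assert (/ 2 <= (1 - x) ^ j) by nra.
nra.
Qed.

(** * Parameters of the lower bound *)

Section LowerParameters.
Variables (n : nat) (r a : R).
Hypotheses (r1 : 1 <= r) (a01 : 0 < a <= 1) (l1 : 1 <= log2 (INR n)).
Hypothesis large : 1024 * (r * log2 (INR n)) ^ 2 <= a * INR n.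

Let l := log2 (INR n).
Let N := INR n.
(** [s] bounds the size of an edge in a downset with [m] edges, since such an edge has
    [2 ^ |e| <= m <= 2 ^ (r l)] subsets. [J], an integer just above [r], is the depth at which
    richness is tested. *)
Let s := S (rnd (r * l)).
Let J := S (rnd r).
Let k := rnd (a * N).
Let m := rnd (Rpower N r).

Lemma lower_N : 1024 <= a * N /\ 1024 <= N.
Proof. unfold N in *; assert (1 <= r * log2 (INR n)) by nra; split; nra. Qed.

Lemma lower_pow : Rpower N r = Rpower 2 (r * l).
Proof.
pose proof lower_N; unfold Rpower, l, log2, N in *; pose proof ln2_gt0; f_equal; field; lra.
Qed.

Lemma lower_s : r * l < INR s <= 2 * (r * l).
Proof.
assert (1 <= r * l) by (unfold l; nra).
destruct (rnd_bounds (r * l)); [lra |]; unfold s; rewrite S_INR; lra.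
Qed.

Lemma lower_J : r < INR J <= 2 * r.
Proof. destruct (rnd_bounds r); [lra |]; unfold J; rewrite S_INR; lra. Qed.

Lemma lower_Jr1 : INR J <= r + 1.
Proof. destruct (rnd_bounds r); [lra |]; unfold J; rewrite S_INR; lra. Qed.

Lemma lower_k : a * N - 1 < INR k <= a * N.
Proof. pose proof lower_N; apply rnd_bounds; lra. Qed.

Lemma lower_m : Rpower N r / 2 <= INR m <= Rpower N r.
Proof.
pose proof lower_N; assert (2 <= Rpower N r).
{ apply Rle_trans with N; [lra |]; rewrite <- (Rpower_1 N) at 1 by lra; apply Rle_Rpower; lra. }
destruct (rnd_bounds (Rpower N r)); [lra |]; fold m in H1, H2; lra.
Qed.

Lemma lower_m_pos : (0 < m)%nat.
Proof.
apply INR_lt; simpl; pose proof lower_m; pose proof (Rpower_gt0 N r); lra.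
Qed.

Lemma lower_m_lt : (m < 2 ^ S s)%nat.
Proof.
apply INR_lt; rewrite pow_INR; simpl INR; replace (1 + 1) with 2 by ring.
apply Rle_lt_trans with (1 := proj2 lower_m); rewrite lower_pow, <- Rpower_pow by lra.
apply Rpower_lt; [lra |]; pose proof lower_s; rewrite S_INR; lra.
Qed.

Lemma lower_rl : 1 <= r * l /\ 1024 * (r * l) ^ 2 <= a * N.
Proof. split; [unfold l; nra | exact large]. Qed.

Lemma lower_sk : (s <= k)%nat.
Proof. apply INR_le; pose proof lower_s; pose proof lower_k; pose proof lower_rl; nra. Qed.

Lemma lower_kn : (k <= n)%nat.
Proof. apply INR_le; pose proof lower_k; pose proof lower_N; fold N; nra. Qed.

Lemma lower_r_le : r <= r * l.
Proof. unfold l; nra. Qed.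

Lemma lower_Jk : (2 * J <= k)%nat.
Proof.
apply INR_le; rewrite mult_INR; simpl (INR 2).
pose proof lower_J; pose proof lower_k; pose proof lower_rl; pose proof lower_r_le; nra.
Qed.

Lemma lower_double j : (j <= s)%nat -> a ^ j <= 2 * (INR (k - s) / INR n) ^ j.
Proof.
intros js; fold N; rewrite minus_INR by exact lower_sk.
pose proof lower_s; pose proof lower_k; pose proof lower_rl; pose proof lower_N.
assert (0 < / N) by (apply Rinv_0_lt_compat; lra).
apply pow_le_double with (y := (INR s + 1) / N) (s := s); try assumption; try lra.
- apply Rmult_le_pos; lra.
- apply (Rmult_le_reg_r N); [lra |].
  replace ((a - (INR s + 1) / N) * N) with (a * N - (INR s + 1)) by (field; lra).
  replace ((INR k - INR s) / N * N) with (INR k - INR s) by (field; lra); lra.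
- apply (Rmult_le_reg_r N); [lra |].
  replace (2 * INR s * ((INR s + 1) / N) * N) with (2 * INR s * (INR s + 1)) by (field; lra); nra.
- unfold s; lia.
Qed.

(** Meant for [X = k / 2 - J]; the summand 1 absorbs the rounding of [k / 2]. *)
Lemma lower_X (X : nat) : (k <= 2 * (X + J) + 1)%nat -> a * N / 8 <= INR X.
Proof.
intros h; apply le_INR in h; rewrite plus_INR, mult_INR, plus_INR in h; simpl (INR 2) in h; simpl (INR 1) in h.
pose proof lower_J; pose proof lower_k; pose proof lower_rl; pose proof lower_r_le; nra.
Qed.

(** The loss factor of [lower_bound_algebra] is rewritten in terms of [r], [l] and [a] by means of
    [s <= 2 r l], [J <= 2 r] and [J + 2 <= r + 3]. *)
Lemma lower_final t X : 0 < t -> (k <= 2 * (X + J) + 1)%nat ->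
  (a * INR X) ^ J <= 2 * INR J ^ J * t \/
  a ^ J * Rpower (Rmax 1 (4 * t * INR J * INR s / INR k)) (log2 (1 + a) - 1) * (INR m - t)
    <= INR J * (INR J * INR s ^ J) * (2 * t) ->
  Rpower N (mu r a) / Rpower (256 * r ^ 2 * l / a ^ 2) (r + 3) <= t.
Proof.
intros t0 hX H.
pose proof lower_s; pose proof lower_J; pose proof lower_k; pose proof lower_rl; pose proof lower_N;
pose proof lower_m; pose proof lower_Jr1.
assert (B : Rpower N (mu r a) <= t * (64 * INR s * INR J / a ^ 2) ^ (J + 2)).
{ apply (lower_bound_algebra N (INR k) (INR m) t a r (INR s) (INR X) J); try lra.
  now apply lower_X. }
assert (0 < / a ^ 2 ) by (apply Rinv_0_lt_compat, pow_lt; lra).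
assert (ia : 1 <= / a ^ 2).
{ rewrite <- Rinv_1; apply Rinv_le_contravar; [apply pow_lt; lra | nra]. }
assert (Q1 : 64 * INR s * INR J / a ^ 2 <= 256 * r ^ 2 * l / a ^ 2).
{ apply Rmult_le_compat_r; [lra |].
  replace (256 * r ^ 2 * l) with (64 * (2 * (r * l)) * (2 * r)) by ring.
  apply Rmult_le_compat; try lra. }
assert (sJ : 1 <= INR s * INR J) by nra.
assert (Q2 : 1 <= 64 * INR s * INR J / a ^ 2) by (unfold Rdiv; nra).
apply (Rmult_le_reg_r (Rpower (256 * r ^ 2 * l / a ^ 2) (r + 3))); [apply Rpower_gt0 |].
unfold Rdiv at 1; rewrite Rmult_assoc, Rinv_l, Rmult_1_r by (apply Rgt_not_eq, Rpower_gt0).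
apply Rle_trans with (1 := B); apply Rmult_le_compat_l; [lra |].
rewrite <- Rpower_pow by lra.
apply Rle_trans with (Rpower (256 * r ^ 2 * l / a ^ 2) (INR (J + 2))).
  apply Rle_Rpower_l; [apply pos_INR | lra].
apply Rle_Rpower; [lra |]; rewrite plus_INR; simpl (INR 2); lra.
Qed.

(** The seed [2 ^ n] of the minimum in [tr] has to satisfy the bound as well. It does because
    [N ^ mu <= N ^ r = 2 ^ (r l)] and [r l <= n]. *)
Lemma lower_triv : Rpower N (mu r a) / Rpower (256 * r ^ 2 * l / a ^ 2) (r + 3) <= 2 ^ n.
Proof.
pose proof lower_rl; pose proof lower_N; pose proof (mu_bounds r a r1 a01).
assert (E1 : 1 <= Rpower (256 * r ^ 2 * l / a ^ 2) (r + 3)).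
{ assert (1 <= / a ^ 2).
  { rewrite <- Rinv_1; apply Rinv_le_contravar; [apply pow_lt; lra | nra]. }
  assert (1 <= r * (r * l)) by nra.
  assert (1 <= 256 * r ^ 2 * l / a ^ 2) by (unfold Rdiv; nra).
  apply Rle_trans with (Rpower (256 * r ^ 2 * l / a ^ 2) 0); [rewrite Rpower_O; lra |].
  apply Rle_Rpower; lra. }
apply Rle_trans with (Rpower N (mu r a)).
  apply (Rmult_le_reg_r (Rpower (256 * r ^ 2 * l / a ^ 2) (r + 3))); [lra |].
  unfold Rdiv at 1; rewrite Rmult_assoc, Rinv_l, Rmult_1_r by lra.
  pose proof (Rpower_gt0 N (mu r a)); nra.
apply Rle_trans with (Rpower N r); [apply Rle_Rpower; lra |].
rewrite lower_pow, <- Rpower_pow by lra; apply Rle_Rpower; [lra |]; fold N; nra.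
Qed.

End LowerParameters.

(** * Size of the loss factors for large n *)

Lemma log2_eventually eps M : 0 < eps -> exists n0 : nat, forall n : nat, (n0 <= n)%nat ->
  M <= log2 (INR n) <= Rpower (INR n) eps.
Proof.
intros e0; pose proof ln2_gt0 as l2.
set (A := Rmax (M * ln 2) (2 / eps * ln (Rmax 1 (2 / eps / ln 2)))).
destruct (rnd_bounds (exp A)) as [h _]; [left; apply exp_pos |].
exists (S (rnd (exp A))); intros n hn.
apply le_INR in hn; rewrite S_INR in hn.
assert (hA : A <= ln (INR n)).
{ rewrite <- (ln_exp A); apply ln_le_mono; [apply exp_pos | lra]. }
pose proof (Rmax_l (M * ln 2) (2 / eps * ln (Rmax 1 (2 / eps / ln 2)))) as h1.
pose proof (Rmax_r (M * ln 2) (2 / eps * ln (Rmax 1 (2 / eps / ln 2)))) as h2.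
fold A in h1, h2; unfold log2; split.
  apply (Rmult_le_reg_r (ln 2)); [assumption |].
  replace (ln (INR n) / ln 2 * ln 2) with (ln (INR n)) by (field; lra); lra.
(* With [c = 2 / (eps ln 2)] one has [log2 n = c ln x <= c x <= x ^ 2 = n ^ eps] once [x >= c],
   which the second entry of [A] ensures. *)
set (x := Rpower (INR n) (eps / 2)).
assert (Ex : ln (INR n) = 2 / eps * ln x) by (unfold x; rewrite ln_Rpower; field; lra).
assert (x0 : 0 < x) by apply Rpower_gt0.
assert (c0 : 0 < 2 / eps) by (apply Rdiv_lt_0_compat; lra).
assert (hx : Rmax 1 (2 / eps / ln 2) <= x).
{ apply Rnot_lt_le; intros bad; apply ln_increasing in bad; [|assumption].
  rewrite Ex in hA; nra. }
assert (hx2 : 2 / eps / ln 2 <= x) by (apply Rle_trans with (2 := hx); apply Rmax_r).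
assert (lx : ln x <= x).
{ pose proof (exp_ineq1_le (ln x)) as h3; rewrite exp_ln in h3 by assumption; lra. }
replace (Rpower (INR n) eps) with (x * x).
2:{ unfold x; rewrite <- Rpower_plus; f_equal; field. }
rewrite Ex; replace (2 / eps * ln x / ln 2) with (2 / eps / ln 2 * ln x) by (field; lra).
assert (0 < 2 / eps / ln 2) by (apply Rdiv_lt_0_compat; lra).
nra.
Qed.

(** Each of 256, [r], [l] and [1 / a] is at most [x = n ^ delta]. Hence
    [1024 (r l) ^ 2 / a <= x ^ 7 <= n], and the loss factor is at most [x ^ (6 (r + 3))]; the
    constant 48 is enough because [mu >= (r + 1) / 2]. *)
Lemma lower_part1 n delta r a : 0 < delta -> 7 * delta <= 1 -> 1 <= r -> 0 < a <= 1 ->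
  256 <= log2 (INR n) <= Rpower (INR n) delta ->
  r <= Rpower (INR n) delta -> / a <= Rpower (INR n) delta ->
  1024 * (r * log2 (INR n)) ^ 2 <= a * INR n /\
  Rpower (INR n) (mu r a * (1 - 48 * delta)) <=
  Rpower (INR n) (mu r a) / Rpower (256 * r ^ 2 * log2 (INR n) / a ^ 2) (r + 3).
Proof.
intros d0 d1 r1 Ha [l1 l2] hr ha; set (N := INR n) in *; set (l := log2 N) in *.
set (x := Rpower N delta) in *.
assert (x1 : 256 <= x) by lra.
assert (N1 : 1 < N).
{ apply Rnot_le_lt; intros bad; unfold l, log2 in l1; pose proof ln2_gt0 as g.
  assert (h : 256 * ln 2 <= ln N).
  { replace (ln N) with (ln N / ln 2 * ln 2) by (field; lra); nra. }
  destruct (Rle_dec N 0) as [b0 | b0].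
    unfold ln at 2 in h; destruct (Rlt_dec 0 N); [lra |]; lra.
  pose proof (ln_le_mono N 1 ltac:(lra) bad); rewrite ln_1 in *; lra. }
assert (Ex : forall j, Rpower N (INR j * delta) = x ^ j).
{ intros j; rewrite Rmult_comm, <- Rpower_mult; apply Rpower_pow; lra. }
assert (ia0 : 1 <= / a) by (rewrite <- Rinv_1; apply Rinv_le_contravar; lra).
split.
- assert (h : r * l <= x * x) by (apply Rmult_le_compat; lra).
  assert (h7 : x ^ 7 <= N).
  { rewrite <- (Ex 7%nat); rewrite <- (Rpower_1 N) at 2 by lra; apply Rle_Rpower; simpl; lra. }
  apply (Rmult_le_reg_l (/ a)); [lra |].
  replace (/ a * (a * N)) with N by (field; lra).
  apply Rle_trans with (2 := h7).
  apply Rle_trans with (x * (x * x * (x * x) ^ 2)); [|right; ring].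
  apply Rmult_le_compat; [lra | | assumption |].
    apply Rmult_le_pos; [lra | apply pow2_ge_0].
  apply Rmult_le_compat; [lra | apply pow2_ge_0 | nra |].
  apply pow_incr; nra.
- replace (mu r a * (1 - 48 * delta)) with (mu r a + - (48 * delta * mu r a)) by ring.
  rewrite Rpower_plus; apply Rmult_le_compat_l; [left; apply Rpower_gt0 |].
  rewrite Rpower_Ropp; apply Rinv_le_contravar; [apply Rpower_gt0 |].
  pose proof (mu_bounds r a r1 Ha) as [hm _].
  assert (hQ : 256 * r ^ 2 * l / a ^ 2 <= x ^ 6).
  { replace (256 * r ^ 2 * l / a ^ 2) with (256 * (r * r * (l * (/ a * / a)))) by (field; lra).
    replace (x ^ 6) with (x * (x * x * (x * (x * x)))) by ring.
    assert (/ a * / a <= x * x) by (apply Rmult_le_compat; lra).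
    assert (r * r <= x * x) by (apply Rmult_le_compat; lra).
    assert (0 <= / a * / a) by nra.
    repeat apply Rmult_le_compat; try lra; try nra.
    apply Rmult_le_pos; [nra | apply Rmult_le_pos; nra]. }
  assert (Q0 : 0 < 256 * r ^ 2 * l / a ^ 2).
  { unfold Rdiv; apply Rmult_lt_0_compat; [nra | apply Rinv_0_lt_compat, pow_lt; lra]. }
  apply Rle_trans with (Rpower (x ^ 6) (r + 3)); [apply Rle_Rpower_l; lra |].
  rewrite <- (Ex 6%nat), Rpower_mult; apply Rle_Rpower; [lra |].
  replace (INR 6) with 6 by (simpl; lra); nra.
Qed.

(** For fixed [r] the number [1024 r ^ 2] is at most [l], so the base of the loss factor is at most
    [l ^ (2 c + 2)]. The exponent [1 / (3 + c)] provides [l ^ (3 + c) <= n], which covers the size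
    condition. *)
Lemma lower_part2 n r c a : 1 <= r -> 0 < c -> 0 < a <= 1 ->
  1024 * r ^ 2 <= log2 (INR n) <= Rpower (INR n) (/ (3 + c)) ->
  / a <= Rpower (log2 (INR n)) c ->
  1024 * (r * log2 (INR n)) ^ 2 <= a * INR n /\
  Rpower (INR n) (mu r a) / Rpower (log2 (INR n)) ((2 * c + 2) * (r + 3)) <=
  Rpower (INR n) (mu r a) / Rpower (256 * r ^ 2 * log2 (INR n) / a ^ 2) (r + 3).
Proof.
intros r1 c0 Ha [l1 l2] ha; set (N := INR n) in *; set (l := log2 N) in *.
assert (lM : 1024 <= l) by nra.
assert (ia0 : 1 <= / a) by (rewrite <- Rinv_1; apply Rinv_le_contravar; lra).
assert (N1 : 0 < N).
{ apply Rnot_le_lt; intros bad; unfold l, log2, ln in lM.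
  destruct (Rlt_dec 0 N); [lra |]; unfold Rdiv in lM; lra. }
set (y := Rpower l c) in *.
assert (Ey : forall j, Rpower l (INR j + c) = l ^ j * y).
{ intros j; unfold y; rewrite Rpower_plus, Rpower_pow by lra; reflexivity. }
split.
- assert (h : l ^ 3 * y <= N).
  { rewrite <- Ey; replace (INR 3) with 3 by (simpl; lra).
    apply Rle_trans with (Rpower (Rpower N (/ (3 + c))) (3 + c)); [apply Rle_Rpower_l; lra |].
    rewrite Rpower_mult, Rinv_l, Rpower_1; lra. }
  apply (Rmult_le_reg_l (/ a)); [lra |].
  replace (/ a * (a * N)) with N by (field; lra).
  apply Rle_trans with (2 := h).
  replace (1024 * (r * l) ^ 2) with (1024 * r ^ 2 * l ^ 2) by ring.
  replace (l ^ 3 * y) with (y * (l * l ^ 2)) by ring.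
  apply Rmult_le_compat; [lra | | assumption |].
    apply Rmult_le_pos; [nra | apply pow2_ge_0].
  apply Rmult_le_compat_r; [apply pow2_ge_0 | lra].
- apply Rmult_le_compat_l; [left; apply Rpower_gt0 |].
  apply Rinv_le_contravar; [apply Rpower_gt0 |].
  rewrite <- Rpower_mult; apply Rle_Rpower_l; [lra |].
  assert (0 < / a * / a) by nra.
  split.
    unfold Rdiv; apply Rmult_lt_0_compat; [nra | apply Rinv_0_lt_compat, pow_lt; lra].
  replace (2 * c + 2) with (c + c + INR 2) by (simpl; ring).
  rewrite !Rpower_plus, Rpower_pow by lra; fold y.
  replace (256 * r ^ 2 * l / a ^ 2) with (/ a * / a * (256 * r ^ 2 * l)) by (field; lra).
  apply Rmult_le_compat; [lra | nra | apply Rmult_le_compat; lra | nra].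
Qed.

Lemma pow_1p_le_exp y (n : nat) : 0 <= y -> (1 + y) ^ n <= exp (INR n * y).
Proof.
intros y0; induction n as [|n IH].
  simpl; rewrite Rmult_0_l, exp_0; lra.
rewrite S_INR; replace ((INR n + 1) * y) with (y + INR n * y) by ring.
rewrite exp_plus; simpl pow; apply Rmult_le_compat; try lra.
  apply pow_le; lra.
apply exp_ineq1_le.
Qed.

(** * Parameters of the upper bound *)

Section UpperParameters.
Variables (n : nat) (r a : R).
Hypotheses (r1 : 1 <= r) (a01 : 0 < a <= 1) (l56 : 56 <= log2 (INR n)).
Hypothesis r_le : r <= sqrt (INR n) / log2 (INR n).

Let l := log2 (INR n).
Let N := INR n.
Let L := log2 (1 + a).
(** By [mu_eq], [2 ^ q] is [n ^ (mu - 1)]. The number [d] of classes is an even integer between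
    [q + 16] and [q + 18], [w] is the class size, and [M] is the number of transversals. The mean of
    [2 ^ (hits - d)] for a random transversal and a set of density [a] is about [g ^ (- d)], which
    dictates [M]. The eighth root [u] of [n] serves as unit in the polynomial estimates. *)
Let q := (r - 1) * l / (2 - L).
Let d' := (S (rnd (q / 2)) + 8)%nat.
Let d := (2 * d')%nat.
Let w := (n / d)%nat.
Let g := 2 / (1 + a).
Let M := S (rnd (N * g ^ d)).
Let k := rnd (a * N).
Let m := rnd (Rpower N r).
Let u := Rpower 2 (l / 8).

Lemma upper_L : 0 < L <= 1.
Proof. now apply log2_1p_bounds. Qed.

Lemma upper_q : 0 <= q <= (r - 1) * l.
Proof.
pose proof upper_L; unfold q, Rdiv.
assert (0 <= (r - 1) * l) by (unfold l; nra).
assert (0 < / (2 - L) <= 1).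
{ split; [apply Rinv_0_lt_compat; lra |].
  rewrite <- Rinv_1; apply Rinv_le_contravar; lra. }
split; nra.
Qed.

Lemma upper_d : q + 16 <= INR d <= q + 18.
Proof.
pose proof upper_q; destruct (rnd_bounds (q / 2)); [lra |].
unfold d, d'; rewrite mult_INR, plus_INR, (S_INR (rnd (q / 2))).
replace (INR 8) with 8 by (simpl; lra); simpl (INR 2); lra.
Qed.

Lemma upper_N : 0 < N.
Proof.
apply Rnot_le_lt; intros bad; unfold log2, ln in l56; fold N in l56.
destruct (Rlt_dec 0 N); [lra |]; unfold Rdiv in l56; lra.
Qed.

Lemma upper_u : 128 <= u /\ N = u ^ 8 /\ sqrt N = u ^ 4.
Proof.
assert (Eu : forall j, Rpower 2 (INR j * (l / 8)) = u ^ j).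
{ intros j; rewrite Rmult_comm, <- Rpower_mult; apply Rpower_pow, Rpower_gt0. }
assert (EN : N = u ^ 8).
{ rewrite <- Eu; replace (INR 8 * (l / 8)) with l by (simpl; field).
  symmetry; apply Rpower2_log2, upper_N. }
split; [| split; [exact EN |]].
- replace 128 with (2 ^ 7) by lra; rewrite <- (Rpower_pow 7) by lra.
  apply Rle_Rpower; [lra |]; fold l in l56; simpl; lra.
- rewrite EN; replace (u ^ 8) with (Rsqr (u ^ 4)) by (unfold Rsqr; ring).
  apply sqrt_Rsqr, pow_le; left; apply Rpower_gt0.
Qed.

(** [d <= q + 18 <= r l - l + 18], with [r l <= sqrt n] and [l >= 56]. *)
Lemma upper_d_sqrt : INR d <= u ^ 4 - 38.
Proof.
pose proof upper_d; pose proof upper_q; destruct upper_u as [_ [_ E]].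
fold l in r_le, l56; fold N in r_le; rewrite E in r_le.
assert (r * l <= u ^ 4).
{ apply (Rmult_le_reg_r (/ l)); [apply Rinv_0_lt_compat; lra |].
  replace (r * l * / l) with r by (field; lra); exact r_le. }
nra.
Qed.

Lemma upper_d'8 : (8 <= d')%nat.
Proof. unfold d'; lia. Qed.

Lemma upper_u4 : 128 ^ 4 <= u ^ 4.
Proof. apply pow_incr; pose proof upper_u; lra. Qed.

Lemma upper_w : N - INR d < INR d * INR w <= N.
Proof.
pose proof upper_d'8 as h; assert (d0 : d <> 0%nat) by (unfold d; lia).
pose proof (Nat.div_mod n d d0) as E; fold w in E.
pose proof (Nat.mod_upper_bound n d d0) as B; apply lt_INR in B.
apply (f_equal INR) in E; rewrite plus_INR, mult_INR in E; fold N in E.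
pose proof (pos_INR (n mod d)); lra.
Qed.

Lemma upper_dw : (d * w <= n)%nat.
Proof. apply INR_le; rewrite mult_INR; apply upper_w. Qed.

Lemma upper_w_ge : u ^ 4 / 2 <= INR w.
Proof.
pose proof upper_w; pose proof upper_d_sqrt; pose proof upper_u4; destruct upper_u as [_ [E _]].
pose proof upper_d; pose proof upper_q.
assert (EN : N = u ^ 4 * u ^ 4) by (rewrite E; ring).
apply Rnot_lt_le; intros bad; set (z := u ^ 4) in *; nra.
Qed.

Lemma upper_w_pos : (0 < w)%nat.
Proof. apply INR_lt; simpl; pose proof upper_w_ge; pose proof upper_u4; lra. Qed.

Lemma upper_n : (1 < n)%nat.
Proof.
apply INR_lt; simpl; fold N; destruct upper_u as [h [E _]]; rewrite E.
apply Rlt_le_trans with (128 ^ 8); [lra |]; apply pow_incr; lra.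
Qed.

Lemma upper_g : 1 <= g <= 2.
Proof.
unfold g; split.
- apply (Rmult_le_reg_r (1 + a)); [lra |]; replace (2 / (1 + a) * (1 + a)) with 2 by (field; lra); lra.
- apply (Rmult_le_reg_r (1 + a)); [lra |]; replace (2 / (1 + a) * (1 + a)) with 2 by (field; lra); lra.
Qed.

Lemma upper_M : N * g ^ d <= INR M <= N * g ^ d + 1.
Proof.
pose proof upper_g; pose proof upper_N.
assert (0 <= g ^ d) by (apply pow_le; lra).
destruct (rnd_bounds (N * g ^ d)); [nra |]; unfold M; rewrite S_INR; lra.
Qed.

(** This makes at least half of the collections of transversals codes. As [M <= 2 N 2 ^ d], the left
    side is at most [8 N ^ 2 64 ^ d']. On the right [w >= u ^ 4 / 2 >= 64 u ^ 3], and [d' >= 8]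
    gives [u ^ (3 d') >= u ^ 24 >= 8 N ^ 2]. *)
Lemma upper_code : (2 * (M * M * 2 ^ d) <= w ^ d')%nat.
Proof.
apply INR_le; rewrite !mult_INR, !pow_INR; simpl (INR 2).
pose proof upper_g; pose proof upper_M; pose proof upper_N; pose proof upper_d'8 as d8.
destruct upper_u as [u1 [E _]].
assert (u0 : 0 < u) by lra.
assert (gd : g ^ d <= 2 ^ d) by (apply pow_incr; lra).
assert (p2 : 1 <= 2 ^ d) by (apply pow_R1_Rle; lra).
assert (N1 : 1 <= N) by (rewrite E; apply pow_R1_Rle; lra).
assert (hM : INR M <= 2 * N * 2 ^ d) by nra.
assert (M0 := pos_INR M).
apply Rle_trans with (8 * N ^ 2 * (64 ^ d')).
{ replace (64 ^ d') with (2 ^ d * 2 ^ d * 2 ^ d).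
  2:{ unfold d; rewrite !pow_mult, <- !Rpow_mult_distr; f_equal; ring. }
  apply Rle_trans with ((1 + 1) * ((2 * N * 2 ^ d) * (2 * N * 2 ^ d) * 2 ^ d)); [|right; ring].
  apply Rmult_le_compat_l; [lra |]; apply Rmult_le_compat_r; [lra |].
  apply Rmult_le_compat; lra. }
apply Rle_trans with ((u ^ 4 / 2) ^ d').
2:{ apply pow_incr; split; [pose proof upper_u4; lra | apply upper_w_ge]. }
apply Rle_trans with ((64 * u ^ 3) ^ d').
{ rewrite Rpow_mult_distr, Rmult_comm; apply Rmult_le_compat_l; [apply pow_le; lra |].
  rewrite <- pow_mult; apply Rle_trans with (u ^ (24)).
  - rewrite E; replace (u ^ 24) with (u * (u ^ 8) ^ 2 * u ^ 7) by ring.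
    assert (u7 : 1 <= u ^ 7) by (apply pow_R1_Rle; lra).
    assert (0 < (u ^ 8) ^ 2) by (apply pow_lt, pow_lt; lra).
    replace (u * (u ^ 8) ^ 2 * u ^ 7) with (u * u ^ 7 * (u ^ 8) ^ 2) by ring.
    apply Rmult_le_compat_r; [lra | clear - u1 u7; nra].
  - apply Rle_pow; [lra | lia]. }
apply pow_incr; split.
- apply Rmult_le_pos; [lra | apply pow_le; lra].
- replace (u ^ 4 / 2) with (u ^ 3 * (u / 2)) by field.
  assert (0 < u ^ 3) by (apply pow_lt; lra). nra.
Qed.

(** The ratio is at most [(1 / g) (1 + d / (N - d))]. Its [d]-th power is at most [3 g ^ (- d)]
    because [d ^ 2 <= N - d], and [M] times this is at most [3 N + 3]. *)
Lemma upper_exp :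
  (1 + (INR (d * w + k) / INR (2 * d * w)) ^ d) ^ M <= exp (8 * N).
Proof.
pose proof upper_g; pose proof upper_M; pose proof upper_N; pose proof upper_w; pose proof upper_d.
pose proof upper_q; pose proof upper_d_sqrt as hd; pose proof upper_u4.
destruct upper_u as [u1 [E _]].
destruct (rnd_bounds (a * N)) as [_ hk]; [nra |]; fold k in hk.
pose proof (pos_INR k) as k0.
rewrite plus_INR, !mult_INR; simpl (INR 2); set (D := INR d) in *; set (W := INR w) in *.
assert (EN : N = u ^ 4 * u ^ 4) by (rewrite E; ring).
assert (hdd : D * D + D <= N) by (rewrite EN; set (z := u ^ 4) in *; nra).
assert (nd0 : 0 < N - D) by nra.
assert (DW : 0 < D * W) by lra.
assert (Y0 : 0 <= (D * W + INR k) / ((1 + 1) * D * W)).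
{ apply Rmult_le_pos; [lra | left; apply Rinv_0_lt_compat; lra]. }
assert (Y1 : (D * W + INR k) / ((1 + 1) * D * W) <= / g * (1 + D / (N - D))).
{ replace ((D * W + INR k) / ((1 + 1) * D * W)) with ((1 + INR k / (D * W)) * / 2).
  2:{ field; split; intros z0; rewrite z0 in DW; lra. }
  replace (/ g * (1 + D / (N - D))) with ((1 + a) * (1 + D / (N - D)) * / 2) by (unfold g; field; lra).
  apply Rmult_le_compat_r; [lra |].
  assert (h : INR k / (D * W) <= a * N / (N - D)).
  { apply Rmult_le_compat; [assumption | left; now apply Rinv_0_lt_compat | lra |].
    apply Rinv_le_contravar; lra. }
  replace (a * N / (N - D)) with (a + a * (D / (N - D))) in h by (field; lra).
  assert (0 <= D / (N - D)) by (apply Rmult_le_pos; [lra | left; now apply Rinv_0_lt_compat]).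
  nra. }
set (Y := (D * W + INR k) / ((1 + 1) * D * W)) in *.
assert (g0 : 0 < / g) by (apply Rinv_0_lt_compat; lra).
assert (Y2 : Y ^ d <= (/ g) ^ d * 3).
{ apply Rle_trans with ((/ g * (1 + D / (N - D))) ^ d); [apply pow_incr; lra |].
  rewrite Rpow_mult_distr; apply Rmult_le_compat_l; [apply pow_le; lra |].
  assert (dn0 : 0 <= D / (N - D)) by (apply Rmult_le_pos; [lra | left; now apply Rinv_0_lt_compat]).
  apply Rle_trans with (1 := pow_1p_le_exp _ d dn0).
  apply Rle_trans with (exp 1); [apply exp_le_mono | apply exp_le_3].
  fold D; apply (Rmult_le_reg_r (N - D)); [assumption |].
  replace (D * (D / (N - D)) * (N - D)) with (D * D) by (field; lra); lra. }
assert (Yd0 : 0 <= Y ^ d) by (apply pow_le; lra).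
apply Rle_trans with (1 := pow_1p_le_exp _ M Yd0); apply exp_le_mono.
assert (gg : g ^ d * (/ g) ^ d = 1) by (rewrite <- Rpow_mult_distr, Rinv_r by lra; apply pow1).
assert (gd1 : 1 <= g ^ d) by (apply pow_R1_Rle; lra).
assert (ig0 : 0 < (/ g) ^ d) by (apply pow_lt; lra).
assert (ig1 : (/ g) ^ d <= 1) by nra.
apply Rle_trans with ((N * g ^ d + 1) * ((/ g) ^ d * 3)).
  apply Rmult_le_compat; try assumption; try lra; apply pos_INR.
replace ((N * g ^ d + 1) * ((/ g) ^ d * 3)) with (3 * N * (g ^ d * (/ g) ^ d) + 3 * (/ g) ^ d) by ring.
rewrite gg; nra.
Qed.

Lemma upper_Npow x : Rpower N x = Rpower 2 (l * x).
Proof. rewrite <- Rpower_mult; f_equal; symmetry; apply Rpower2_log2, upper_N. Qed.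

(** From [2 g = 2 ^ (2 - L)] the right side is at least [N 2 ^ ((2 - L) d)], and
    [(2 - L) q = (r - 1) l]; the surplus of 16 in [d] pays for the factor 2, needed since only about
    half of the subsets of a transversal are kept. *)
Lemma upper_m : (2 * m <= M * 2 ^ d)%nat.
Proof.
apply INR_le; rewrite !mult_INR, pow_INR; simpl (INR 2).
pose proof upper_N as N0; pose proof upper_M as [hM _]; pose proof upper_L as HL; pose proof upper_d.
destruct (rnd_bounds (Rpower N r)) as [_ hm]; [left; apply Rpower_gt0 |]; fold m in hm.
assert (p2 : 0 < 2 ^ d) by (apply pow_lt; lra).
apply Rle_trans with (N * g ^ d * (1 + 1) ^ d).
2:{ apply Rmult_le_compat_r; [replace (1 + 1) with 2 by ring; lra | assumption]. }
assert (E : N * g ^ d * (1 + 1) ^ d = Rpower 2 (l + (2 - L) * INR d)).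
{ rewrite Rmult_assoc, <- Rpow_mult_distr.
  replace (g * (1 + 1)) with (Rpower 2 (2 - L)).
  - rewrite Rpower_plus, <- Rpower_mult, Rpower_pow by apply Rpower_gt0.
    f_equal; symmetry; apply Rpower2_log2; assumption.
  - unfold Rminus; rewrite Rpower_plus, Rpower_Ropp; unfold L; rewrite Rpower2_log2 by lra.
    replace 2 with (INR 2) at 2 by (simpl; ring); rewrite Rpower_pow by lra; unfold g; field; lra. }
rewrite E; apply Rle_trans with (2 * Rpower 2 (l * r)).
  rewrite <- upper_Npow; lra.
rewrite <- (Rpower_1 2) at 1 by lra; rewrite <- Rpower_plus; apply Rle_Rpower; [lra |].
assert ((2 - L) * (q + 16) <= (2 - L) * INR d) by nra.
assert ((2 - L) * q = (r - 1) * l) by (unfold q; field; lra).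
nra.
Qed.

Lemma upper_trace : INR (20 * n * 2 ^ d) <= 20 * 2 ^ 18 * Rpower N (mu r a).
Proof.
pose proof upper_N as N0; pose proof upper_L as HL; pose proof upper_d.
rewrite !mult_INR, pow_INR; simpl (INR 2); replace (INR 20) with 20 by (simpl; ring); fold N.
replace ((1 + 1) ^ d) with (Rpower 2 (INR d)) by (rewrite Rpower_pow by lra; f_equal; ring).
rewrite !Rmult_assoc; apply Rmult_le_compat_l; [lra |].
rewrite mu_eq by assumption; fold L; rewrite Rpower_plus, Rpower_1 by assumption.
rewrite <- Rmult_assoc, (Rmult_comm (2 ^ 18)), Rmult_assoc; apply Rmult_le_compat_l; [lra |].
rewrite upper_Npow, <- (Rpower_pow 18) by lra; rewrite <- Rpower_plus.
apply Rle_Rpower; [lra |].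
replace (l * ((r - 1) / (2 - L))) with q by (unfold q; field; lra).
replace (INR 18) with 18 by (simpl; ring); lra.
Qed.

End UpperParameters.

End RealEstimates.

Module Traces.
Import RealEstimates.
Import all_boot all_order all_algebra zify Rstruct.
Import Order.TTheory GRing.Theory Num.Theory.
Local Open Scope nat_scope.
Set Implicit Arguments.
Unset Strict Implicit.
Unset Printing Implicit Defensive.

(** * Down-compression *)

Section Compression.
Variable T : finType.
Implicit Types (F G : {set {set T}}) (A B I e : {set T}) (v : T).

Definition downset F := forall e e', e \in F -> e' \subset e -> e' \in F.

Definition shift F v e := if (v \in e) && (e :\ v \notin F) then e :\ v else e.

Lemma shift_inj F v : {in F &, injective (shift F v)}.
Proof.
move=> e e' eF e'F; rewrite /shift.
case: ifP => [/andP[ve nF]|_]; case: ifP => [/andP[ve' nF']|_] // E.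
- by rewrite -(setD1K ve) -(setD1K ve') E.
- by rewrite E e'F in nF.
- by rewrite -E eF in nF'.
Qed.

(** If [e] loses [v], its new trace is either a trace of [F] already, fixed by the shift, or the
    shifted image of [e :&: I]. If [e] stays because [e :\ v] is an edge, then [(e :&: I) :\ v] is a
    trace, so [e :&: I] stays too. *)
Lemma shift_trace_sub F v I : v \in I ->
  [set e :&: I | e in shift F v @: F] \subset
  shift [set e :&: I | e in F] v @: [set e :&: I | e in F].
Proof.
move=> vI; apply/subsetP=> _ /imsetP[_ /imsetP[e eF ->] ->].
have trF e' : e' \in F -> e' :&: I \in [set e :&: I | e in F].
  by move=> h; apply/imsetP; exists e'.
have D1I e' : (e' :&: I) :\ v = (e' :\ v) :&: I by rewrite setIDAC.
rewrite {1}/shift; case: ifP => [/andP[ve nF]|].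
  case: (boolP ((e :\ v) :&: I \in [set e :&: I | e in F])) => h.
    apply/imsetP; exists ((e :\ v) :&: I) => //.
    by rewrite /shift !inE eqxx.
  apply/imsetP; exists (e :&: I); first exact: trF.
  by rewrite /shift inE ve vI /= D1I h.
move/negbT; rewrite negb_and negbK => h.
apply/imsetP; exists (e :&: I); first exact: trF.
rewrite /shift inE; case: (boolP (v \in e)) h => //= ve h.
by rewrite vI /= D1I trF.
Qed.

Lemma shift_trace_card F v I :
  #|[set e :&: I | e in shift F v @: F]| <= #|[set e :&: I | e in F]|.
Proof.
case: (boolP (v \in I)) => vI.
  apply: leq_trans (subset_leq_card (shift_trace_sub F vI)) _.
  exact: leq_imset_card.
apply: subset_leq_card; apply/subsetP=> _ /imsetP[_ /imsetP[e eF ->] ->].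
apply/imsetP; exists e => //; rewrite /shift; case: ifP => // _.
apply/setP=> x; rewrite !inE; case: (eqVneq x v) => [->|_] //=.
by rewrite (negbTE vI) andbF.
Qed.

(* Down-compression: the family of least total size is invariant under all
   shifts, hence a downset. *)
Lemma compression F : exists F', [/\ downset F', #|F'| = #|F| &
  forall I, #|[set e in F' | e \subset I]| <= #|[set e :&: I | e in F]|].
Proof.
pose P F' := (#|F'| == #|F|) &&
  [forall I : {set T}, #|[set e :&: I | e in F']| <= #|[set e :&: I | e in F]|].
have P0 : P F by rewrite /P eqxx /=; apply/forallP.
case: (@arg_minnP _ F P (fun F' => \sum_(e in F') #|e|) P0) => F'.
move=> /andP[/eqP cF' /forallP tF'] minF'.
have sub1 e v : e \in F' -> v \in e -> e :\ v \in F'.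
  move=> eF ve; apply/negPn/negP => nF.
  have := minF' (shift F' v @: F'); rewrite /P card_in_imset ?cF' ?eqxx /=;
    last exact: shift_inj.
  have -> : [forall I : {set T}, #|[set e :&: I | e in shift F' v @: F']| <=
       #|[set e :&: I | e in F]|].
    by apply/forallP=> I; apply: leq_trans (shift_trace_card _ _ _) (tF' I).
  move=> /(_ isT); rewrite big_imset /=; last exact: shift_inj.
  rewrite leqNgt => /negP; apply.
  rewrite (bigD1 e) //= [X in _ < X](bigD1 e) //= -addSn leq_add //.
    by rewrite /shift ve nF /= [X in _ < X](cardsD1 v) ve.
  apply: leq_sum => e' _; rewrite /shift; case: ifP => // _.
  by apply: subset_leq_card; apply: subsetDl.
have dF' : downset F'.
  move=> e e'; move: {2}#|e :\: e'| (erefl #|e :\: e'|) => k.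
  elim: k e => [|k IH] e ck eF sub.
    have /eqP := ck; rewrite cards_eq0 setD_eq0 => s2.
    by have -> : e' = e by apply/eqP; rewrite eqEsubset sub.
  have /card_gt0P[v] : 0 < #|e :\: e'| by rewrite ck.
  rewrite inE => /andP[nv ve].
  apply: (IH (e :\ v)); last 1 first.
  - by apply/subsetP=> x xe'; rewrite !inE (subsetP sub) // andbT; apply: contraNneq nv => <-.
  - have h : v \in e :\: e' by rewrite inE nv.
    move: ck; rewrite (cardsD1 v) h => -[<-]; apply: eq_card => x.
    by rewrite !inE andbCA.
  - exact: sub1.
exists F'; split=> // I; apply: leq_trans (tF' I).
apply: subset_leq_card; apply/subsetP=> e; rewrite inE => /andP[eF /setIidPl eI].
by apply/imsetP; exists e.
Qed.

Lemma downset_card F e : downset F -> e \in F -> 2 ^ #|e| <= #|F|.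
Proof.
move=> dF eF; rewrite -card_powerset; apply: subset_leq_card.
by apply/subsetP=> A; rewrite inE; apply: dF.
Qed.

End Compression.

(** * Weights of downsets *)

Section Weight.
Local Open Scope ring_scope.
Variables (T : finType) (R : realFieldType) (a : R).
Hypothesis a_ge0 : 0 <= a.
Implicit Types (F G C : {set {set T}}) (A B I S U e : {set T}) (v : T).

(** For [a] in [0, 1] this is the expected number of edges inside a random vertex set that contains
    each vertex independently with probability [a]. *)
Definition wt F : R := \sum_(e in F) a ^+ #|e|.

Lemma wt_sub F G : F \subset G -> wt F <= wt G.
Proof.
move=> sFG; rewrite /wt [leRHS](big_setID F) /= (setIidPr sFG) lerDl.
by apply: sumr_ge0 => e _; apply: exprn_ge0.
Qed.

Lemma wtU F G : [disjoint F & G] -> wt (F :|: G) = wt F + wt G.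
Proof. by move=> d; rewrite /wt -bigU //; apply: eq_bigl => e; rewrite !inE. Qed.

Lemma wt_imset_setU F A : (forall e, e \in F -> [disjoint A & e]) ->
  wt [set A :|: e | e in F] = a ^+ #|A| * wt F.
Proof.
move=> dis; rewrite /wt big_imset /=; last first.
  move=> e e' /dis d /dis d' E; apply/setP=> x.
  case: (boolP (x \in A)) => xA.
    by rewrite (disjointFr d xA) (disjointFr d' xA).
  by move/setP/(_ x): E; rewrite !inE (negbTE xA).
rewrite mulr_sumr; apply: eq_bigr => e /dis d.
by rewrite cardsU disjoint_setI0 // cards0 subn0 exprD.
Qed.

(** Split at a vertex [v] into the edges avoiding [v] and those containing it. The link [F1] of [v]
    lies in [F0'] as [F] is a downset, so [wt F = wt F0' + a * wt F1] with [#|F1| <= #|F0'|], and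
    the inequality for [phi] closes the induction. The intended [phi] is [x ^ log2 (1 + a)]. *)
Lemma downset_wt_ge (phi : nat -> R) F :
    phi 1%N <= 1 ->
    (forall x y, (0 < y <= x)%N -> phi (x + y)%N <= phi x + a * phi y) ->
  downset F -> set0 \in F -> phi #|F| <= wt F.
Proof.
move=> phi1 phiD; move: {2}#|F|.+1 (ltnSn #|F|) => k.
elim: k F => // k IH F Fk dF F0.
case: (boolP [exists v, [set v] \in F]) => [/existsP[v vF]|/existsPn nF]; last first.
  have -> : F = [set set0].
    apply/setP=> e; rewrite inE; apply/idP/eqP => [eF|-> //].
    case: (set_0Vmem e) => // -[v ve]; case/negP: (nF v).
    by apply: dF eF _; rewrite sub1set.
  by rewrite cards1 /wt big_set1 cards0 expr0.
pose F0' := [set e in F | v \notin e].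
pose F1 := [set e in F0' | v |: e \in F].
have dF0 : downset F0'.
  move=> e e'; rewrite !inE => /andP[eF ve] sub; rewrite (dF _ _ eF sub) /=.
  by apply: contra ve; apply: (subsetP sub).
have dF1 : downset F1.
  move=> e e' /[!inE] /andP[eF0 eF] sub; have := dF0 _ _ _ sub; rewrite !inE => -> //=.
  by apply: dF eF _; apply: setUS.
have F1F0 : F1 \subset F0' by apply/subsetP=> e; rewrite inE => /andP[].
have z0 : set0 \in F0' by rewrite !inE F0.
have z1 : set0 \in F1 by rewrite inE z0 setU0.
have dv e : e \in F1 -> [disjoint [set v] & e].
  by rewrite !inE => /andP[/andP[_ ve] _]; rewrite disjoints1.
have EF : F = F0' :|: [set [set v] :|: e | e in F1].
  apply/setP=> e; rewrite inE; apply/idP/orP.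
    move=> eF; case: (boolP (v \in e)) => ve; last by left; rewrite inE eF.
    right; apply/imsetP; exists (e :\ v); last by rewrite setD1K.
    rewrite !inE eqxx setD1K // eF /= !andbT.
    by apply: dF eF _; apply: subsetDl.
  case=> [|/imsetP[e']]; first by rewrite inE => /andP[].
  by rewrite inE => /andP[_ eF] ->.
have dis : [disjoint F0' & [set [set v] :|: e | e in F1]].
  apply/pred0P => e /=; apply/negP => /andP[]; rewrite inE => /andP[_ /negP ve].
  by move=> /imsetP[e' _ ee]; apply: ve; rewrite ee !inE eqxx.
have cF : #|F| = (#|F0'| + #|F1|)%N.
  rewrite {1}EF cardsU disjoint_setI0 // cards0 subn0; congr (_ + _)%N.
  rewrite card_in_imset // => e e' /dv; rewrite disjoints1 => h /dv; rewrite disjoints1 => h' E.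
  by rewrite -(setU1K h) -(setU1K h') E.
have p1 : (0 < #|F1|)%N by rewrite card_gt0; apply/set0Pn; exists set0.
have p0 : (0 < #|F0'|)%N by rewrite card_gt0; apply/set0Pn; exists set0.
have l10 := subset_leq_card F1F0.
rewrite {2}EF wtU // wt_imset_setU // cards1 expr1 cF.
apply: le_trans (phiD _ _ _) _; first by rewrite p1.
rewrite cF in Fk.
by apply: lerD; [|apply: ler_wpM2l => //]; apply: IH => //; lia.
Qed.

Definition down G := [set e : {set T} | [exists B in G, e \subset B]].

Lemma sub_down G : G \subset down G.
Proof. by apply/subsetP=> B BG; rewrite inE; apply/existsP; exists B; rewrite BG /=. Qed.

Lemma downP G e : reflect (exists2 B, B \in G & e \subset B) (e \in down G).
Proof.
by rewrite inE; apply: (iffP existsP) => [[B /andP[]]|[B]]; exists B => //; apply/andP.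
Qed.

Lemma downset_down G : downset (down G).
Proof. by move=> e e' /downP[B BG eB] sub; apply/downP; exists B => //; apply: subset_trans eB. Qed.

(* Each set is charged to its first vertex in an elimination ordering; the sets
   charged to one vertex have a small link, on which the hypothesis applies. *)
Lemma degenerate_wt_ge (kappa : R) (small : pred nat) G S :
    0 <= kappa -> kappa * a <= 1 ->
    (forall C, small #|C| -> kappa * #|C|%:R <= wt (down C)) ->
    (forall U, U \subset S -> U != set0 -> exists2 v, v \in U &
       small #|[set B in G | (B \subset U) && (v \in B)]|) ->
    G \subset powerset S ->
  kappa * a * #|G|%:R <= wt (down G).
Proof.
move=> k0 ka Hk HU GS.
have main n U : #|U| = n -> U \subset S ->
    kappa * a * #|[set B in G | B \subset U]|%:R <= wt (down [set B in G | B \subset U]).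
  elim: n U => [|n IH] U cU US.
    move/eqP: cU; rewrite cards_eq0 => /eqP ->.
    have h : [set B in G | B \subset set0] \subset [set set0].
      by apply/subsetP=> B; rewrite !inE subset0 => /andP[].
    have [->|->] : [set B in G | B \subset set0] = set0 \/
        [set B in G | B \subset set0] = [set set0].
      by move: h; rewrite subset1 => /orP[] /eqP; auto.
      by rewrite cards0 mulr0; apply: sumr_ge0 => e _; apply: exprn_ge0.
    rewrite cards1 mulr1; apply: le_trans ka _.
    apply: le_trans (wt_sub (sub_down _)).
    by rewrite /wt big_set1 cards0 expr0.
  have U0 : U != set0 by rewrite -card_gt0 cU.
  have [v vU sm] := HU U US U0.
  set Gv := [set B in G | (B \subset U) && (v \in B)] in sm.
  pose G' := [set B in G | B \subset U :\ v].
  pose L := [set B :\ v | B in Gv].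
  have cL : #|L| = #|Gv|.
    rewrite card_in_imset // => B B'; rewrite !inE => /and3P[_ _ h] /and3P[_ _ h'] E.
    by rewrite -(setD1K h) -(setD1K h') E.
  have EG : [set B in G | B \subset U] = G' :|: Gv.
    apply/setP=> B; rewrite !inE subsetD1; case: (B \in G) => //=.
    by case: (B \subset U) => //=; case: (v \in B).
  have disG : [disjoint G' & Gv].
    apply/pred0P => B /=; apply/negP; rewrite !inE subsetD1.
    by case: (v \in B); rewrite /= ?andbF.
  have IH' : kappa * a * #|G'|%:R <= wt (down G').
    apply: IH; first by move: cU; rewrite (cardsD1 v) vU => -[].
    by apply: subset_trans US; apply: subsetDl.
  have IHv : kappa * #|Gv|%:R <= wt (down L) by rewrite -cL; apply: Hk; rewrite cL.
  have nv e : e \in down L -> v \notin e.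
    case/downP => _ /imsetP[B _ ->] sub; apply/negP => /(subsetP sub).
    by rewrite !inE eqxx.
  have nv' e : e \in down G' -> v \notin e.
    case/downP => B; rewrite inE => /andP[_] sB sub; apply/negP => /(subsetP sub)/(subsetP sB).
    by rewrite !inE eqxx.
  (* Sets below [G'] avoid [v] while those built from the link [L] contain it, so the two weights
     add up. *)
  have dis : [disjoint down G' & [set [set v] :|: e | e in down L]].
    apply/pred0P => e /=; apply/negP => /andP[/nv' /negP h /imsetP[e' _ E]]; apply: h.
    by rewrite E !inE eqxx.
  have sub : down G' :|: [set [set v] :|: e | e in down L] \subset down [set B in G | B \subset U].
    apply/subsetP=> e; rewrite inE => /orP[/downP[B BG eB]|/imsetP[e' /downP[_ /imsetP[B BG ->] eB] ->]].
      by apply/downP; exists B => //; rewrite EG inE BG.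
    apply/downP; exists B; first by rewrite EG inE BG orbT.
    rewrite subUset sub1set; move: BG; rewrite !inE => /and3P[_ _ ->] /=.
    by apply: subset_trans eB _; apply: subsetDl.
  apply: le_trans (wt_sub sub); rewrite wtU // wt_imset_setU; last first.
    by move=> e /nv; rewrite disjoints1.
  rewrite cards1 expr1 EG cardsU disjoint_setI0 // cards0 subn0 natrD mulrDr.
  apply: lerD => //; rewrite (mulrC kappa) -mulrA; exact: ler_wpM2l.
have -> : G = [set B in G | B \subset S].
  apply/setP=> B; rewrite inE; case: (boolP (B \in G)) => //= /(subsetP GS).
  by rewrite inE => ->.
exact: main.
Qed.

End Weight.

(** * Rich sets, dense spots and sampling *)

Section Rank.
Variables (T : finType) (F : {set {set T}}) (X : nat).
Implicit Types (A B I S U e : {set T}) (v : T).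

(* If [set0] is [J]-rich then [F] has many [J]-sets; otherwise walking up inside
   an edge, always to a vertex that lowers the richness, gets stuck after fewer
   than [J] steps at a set with few extensions of its own level. *)
Fixpoint rich i A : bool :=
  if i is i'.+1 then X < #|[set v | (v \notin A) && rich i' (v |: A)]| else A \in F.

Definition rich_ext i A := [set v | (v \notin A) && rich i (v |: A)].

(** Double count pairs of an extension vertex [v] and a set [e] containing it: each of more than [X]
    vertices contributes at least [X ^ i / i!] sets, and each [e] is met at most once per element of
    [e :\: A], hence [i + 1] times. *)
Lemma rich_count i A : rich i A ->
  X ^ i <= i`! * #|[set e in F | (A \subset e) && (#|e| == #|A| + i)]|.
Proof.
elim: i A => [|i IH] A /=.
  move=> AF; rewrite expn0 fact0 mul1n card_gt0; apply/set0Pn; exists A.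
  by rewrite inE AF subxx addn0 eqxx.
rewrite -/(rich_ext i A) => /ltnW hX.
set E := [set e in F | _].
have step v : v \in rich_ext i A -> X ^ i <= i`! * #|[set e in E | v \in e]|.
  rewrite inE => /andP[vA] /IH h; apply: leq_trans h _; rewrite leq_mul2l.
  apply/orP; right; apply: subset_leq_card; apply/subsetP=> e; rewrite !inE.
  by rewrite cardsU1 vA subUset sub1set add1n addSnnS => /and3P[-> /andP[-> ->] ->].
have : X * X ^ i <= \sum_(v in rich_ext i A) i`! * #|[set e in E | v \in e]|.
  apply: (@leq_trans (\sum_(v in rich_ext i A) X ^ i)).
    by rewrite sum_nat_const leq_mul2r hX orbT.
  by apply: leq_sum => v /step.
rewrite expnS => /leq_trans; apply.
rewrite -big_distrr /= factS (mulnC i.+1) -mulnA leq_mul2l; apply/orP; right.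
under eq_bigr do rewrite -sum1_card.
rewrite (exchange_big_dep (fun e => e \in E)) /=; last by move=> v e _; rewrite inE => /andP[].
rewrite mulnC -sum_nat_const; apply: leq_sum => e eE.
rewrite (eq_bigl (fun v => v \in rich_ext i A :&: e)); last first.
  by move=> v; rewrite in_setI; congr (_ && _); rewrite in_set eE.
rewrite sum1_card; have := eE; rewrite inE => /and3P[_ Ae /eqP ce].
have -> : i.+1 = #|e :\: A| by rewrite cardsD (setIidPr Ae) ce addKn.
apply: subset_leq_card; apply/subsetP=> v; rewrite !inE => /andP[/andP[-> _] ->].
by [].
Qed.

(** A vertex [v] of [e :\: A] outside [rich_ext i A] makes [v |: A] fail richness at level [i], and
    the walk continues there with [#|A| + i] unchanged. It stops before level 0 fails, because every
    subset of [e] is an edge. *)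
Lemma rich_cover i A e : downset F -> e \in F -> A \subset e -> ~~ rich i A ->
  exists A' i', [/\ A' \subset e, #|A'| < #|A| + i, i' < i,
     #|rich_ext i' A'| <= X & e :\: A' \subset rich_ext i' A'].
Proof.
move=> dF eF; elim: i A => [|i IH] A Ae /=; first by rewrite (dF _ _ eF Ae).
rewrite -/(rich_ext i A) -leqNgt => hX.
case: (boolP (e :\: A \subset rich_ext i A)) => [sub|/subsetPn[v]].
  by exists A, i; split=> //; rewrite addnS ltnS leq_addr.
rewrite !inE => /andP[vA ve]; rewrite vA /= => nr.
have [|A' [i' [s1 s2 s3 s4 s5]]] := IH (v |: A) _ nr.
  by rewrite subUset sub1set ve.
exists A', i'; split=> //; last exact: ltnW.
by move: s2; rewrite cardsU1 vA add1n addSnnS.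
Qed.

End Rank.

Section DenseSpots.
Variable (T : finType).
Implicit Types (F : {set {set T}}) (A B I S U e : {set T}) (v : T).

(** Choose [I] of maximal size among the sets of at most [k] vertices spanning at least
    [4 t |I| / k] edges, and delete the at most [t] edges inside it. A set [S] still too dense could
    be joined to [I], against maximality. *)
Lemma remove_dense_spots F k t : 0 < t ->
    (forall I, #|I| <= k -> #|[set e in F | e \subset I]| <= t) ->
  exists F' : {set {set T}}, [/\ F' \subset F, #|F| <= #|F'| + t &
    forall S, 2 * #|S| <= k -> k * #|[set e in F' | e \subset S]| <= 4 * t * #|S|].
Proof.
move=> t0 ht; pose N I := #|[set e in F | e \subset I]|.
pose P I := (#|I| <= k) && (4 * t * #|I| <= k * N I).
have P0 : P set0 by rewrite /P cards0 muln0.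
case: (@arg_maxnP _ set0 P (fun I => #|I|) P0) => I /andP[Ik PI] maxI.
pose F' := [set e in F | ~~ (e \subset I)].
have EI := cardsID [set e : {set T} | e \subset I] F.
exists F'; split.
- by apply/subsetP=> e; rewrite inE => /andP[].
- rewrite -EI addnC; apply: leq_add.
    by apply: subset_leq_card; apply/subsetP=> e; rewrite !inE andbC.
  apply: leq_trans (ht I Ik); apply: subset_leq_card; apply/subsetP=> e.
  by rewrite !inE.
move=> S Sk; case: (boolP (S \subset I)) => [SI|nSI].
  rewrite [X in _ * X](_ : _ = 0) ?muln0 //; apply/eqP; rewrite cards_eq0.
  apply/eqP/setP=> e; rewrite !inE; apply/negP => /andP[/andP[_ /negP h] eS].
  by apply: h; apply: subset_trans SI.
(* Being dense yet spanning at most [t] edges forces [I] to be small, which leaves room for [S]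
   within [k] vertices. *)
have I4 : 4 * #|I| <= k.
  rewrite -(leq_pmul2l t0) mulnA (mulnC t 4) (leq_trans PI) // mulnC leq_mul2r.
  by rewrite ht // orbT.
have cU : #|I :|: S| <= k.
  by rewrite cardsU; apply: leq_trans (leq_subr _ _) _; lia.
have ltU : #|I| < #|I :|: S|.
  apply: proper_card; rewrite properE subsetUl /=; apply: contra nSI.
  by apply: subset_trans; apply: subsetUr.
have nP : k * N (I :|: S) < 4 * t * #|I :|: S|.
  rewrite ltnNge; apply/negP => h; have := maxI (I :|: S); rewrite /P cU h.
  by move=> /(_ isT) /= h'; have := leq_ltn_trans h' ltU; rewrite ltnn.
have le1 : N I + #|[set e in F' | e \subset S]| <= N (I :|: S).
  rewrite /N -cardsUI [X in _ + X](_ : _ = 0) ?addn0; last first.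
    apply/eqP; rewrite cards_eq0; apply/eqP/setP=> e; rewrite !inE.
    by case: (e \in F) => //=; case: (e \subset I).
  apply: subset_leq_card; apply/subsetP=> e.
  rewrite !inE => /orP[/andP[-> h]|/andP[/andP[-> _] h]] /=.
    exact: subset_trans (subsetUl _ _).
  exact: subset_trans (subsetUr _ _).
have cU2 : #|I :|: S| <= #|I| + #|S| by rewrite cardsU leq_subr.
have := leq_mul (leqnn k) le1; rewrite mulnDr => h1.
have := leq_mul (leqnn (4 * t)) cU2; rewrite mulnDr => h2.
lia.
Qed.

End DenseSpots.

Section Sampling.
Local Open Scope ring_scope.
Variables (T : finType) (R : realFieldType).
Implicit Types (F : {set {set T}}) (I e : {set T}).

(** A random [k]-set contains [j] given vertices with probability the product of [(k - i) / (n - i)]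
    over [i < j], and each factor is at least [(k - s) / n]. *)
Lemma bin_sub_ge (n k s j : nat) : (j <= s)%N -> (s <= k)%N -> (k <= n)%N ->
  ('C(n, k) * (k - s) ^ j <= 'C(n - j, k - j) * n ^ j)%N.
Proof.
move=> js sk kn; elim: j js => [|j IH] js; first by rewrite !subn0 !muln1.
have := IH (ltnW js) => {}IH.
have E := mul_bin_diag (n - j) (k - j.+1).
have e1 : ((k - j.+1).+1 = k - j)%N by lia.
have e2 : ((n - j).-1 = n - j.+1)%N by lia.
rewrite e1 e2 in E.
rewrite !expnS mulnCA (mulnCA _ n); apply: (@leq_trans ((k - s) * ('C(n - j, k - j) * n ^ j))).
  by rewrite leq_mul2l IH orbT.
rewrite !mulnA leq_mul2r; apply/orP; right.
apply: (@leq_trans ((k - j) * 'C(n - j, k - j))); first by rewrite leq_mul2r; lia.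
by rewrite -E leq_mul2r; lia.
Qed.

Lemma card_supersets_ge k e : (#|e| <= k)%N ->
  ('C(#|T| - #|e|, k - #|e|) <= #|[set I : {set T} | (#|I| == k) && (e \subset I)]|)%N.
Proof.
move=> ek.
have <- : #|~: e| = (#|T| - #|e|)%N by rewrite -(cardsC e) addKn.
rewrite -cards_draws; pose D := [set A : {set T} | A \subset ~: e & #|A| == (k - #|e|)%N].
rewrite -/D; have inj : {in D &, injective (fun A => e :|: A)}.
  move=> A B; rewrite !inE => /andP[As _] /andP[Bs _] E; apply/setP=> x.
  case: (boolP (x \in e)) => xe.
    have := subsetP As x; have := subsetP Bs x; rewrite inE xe.
    by case: (x \in A) => [_ /(_ isT)|]; case: (x \in B) => // /(_ isT).
  by move/setP/(_ x): E; rewrite !inE (negbTE xe).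
rewrite -(card_in_imset inj); apply: subset_leq_card; apply/subsetP=> _ /imsetP[A + ->].
rewrite !inE subsetUl andbT => /andP[As /eqP cA].
by rewrite cardsU disjoint_setI0 ?cards0 ?subn0 ?cA ?subnKC // disjoint_sym disjoints_subset.
Qed.

(** Average over all [k]-sets [I] the number of edges inside [I]: an edge [e] lies in [I] with
    probability at least [((k - s) / n) ^ |e|], so the mean is at least this weight, and it is at
    most [t]. *)
Lemma wt_le_max_induced F (k s t : nat) :
    (0 < k)%N -> (s <= k)%N -> (k <= #|T|)%N -> (forall e, e \in F -> (#|e| <= s)%N) ->
    (forall I, #|I| = k -> (#|[set e in F | e \subset I]| <= t)%N) ->
  wt ((k - s)%:R / #|T|%:R : R) F <= t%:R.
Proof.
move=> k0 sk kn hs ht.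
have sumle : (\sum_(e in F) 'C(#|T| - #|e|, k - #|e|) <= t * 'C(#|T|, k))%N.
  apply: (@leq_trans (\sum_(e in F) \sum_(I : {set T} | (#|I| == k) && (e \subset I)) 1)).
    apply: leq_sum => e /hs es; apply: leq_trans (card_supersets_ge (leq_trans es sk)) _.
    by rewrite -sum1_card; apply: eq_leq; apply: eq_bigl => I; rewrite inE.
  rewrite (exchange_big_dep (fun I => #|I| == k)) /=; last by move=> e I _ /andP[].
  apply: (@leq_trans (\sum_(I : {set T} | #|I| == k) t)).
    apply: leq_sum => I /eqP Ik; apply: leq_trans (ht I Ik).
    rewrite -[leqRHS]sum1_card; apply: eq_leq; apply: eq_bigl => e; by rewrite inE Ik eqxx.
  rewrite sum_nat_const mulnC leq_mul2l; apply/orP; right; apply: eq_leq.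
  by rewrite -(card_draws T k); apply: eq_card => I; rewrite !inE.
have C0 : (0 < 'C(#|T|, k)%:R :> R) by rewrite ltr0n bin_gt0.
have n0 : (0 < #|T|%:R :> R) by rewrite ltr0n (leq_trans k0).
rewrite -(ler_pM2r C0) -natrM; apply: le_trans (_ : (\sum_(e in F) 'C(#|T| - #|e|, k - #|e|))%:R <= _);
  last by rewrite ler_nat.
rewrite natr_sum /wt mulr_suml; apply: ler_sum => e /hs es.
rewrite exprMn exprVn mulrAC ler_pdivrMr ?exprn_gt0 // mulrC.
by rewrite -!natrX -!natrM ler_nat bin_sub_ge.
Qed.

End Sampling.

Lemma card_bigcup_le (I T : finType) (P : pred I) (A : I -> {set T}) :
  #|\bigcup_(i | P i) A i| <= \sum_(i | P i) #|A i|.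
Proof.
elim/big_rec2: _ => [|i m B _ h]; first by rewrite cards0.
by rewrite cardsU; apply: leq_trans (leq_subr _ _) _; rewrite leq_add2l.
Qed.

Lemma bin_le_exp n j : ('C(n, j) <= n ^ j)%N.
Proof.
apply: (@leq_trans (n ^_ j)); first by rewrite -bin_ffact leq_pmulr // fact_gt0.
elim: j => [|j IH]; first by rewrite ffactn0.
by rewrite ffactnSr expnSr leq_mul // leq_subr.
Qed.

Lemma card_small_subsets (T : finType) (e : {set T}) s J : (0 < s)%N -> (#|e| <= s)%N ->
  (#|[set A : {set T} | (#|A| < J)%N && (A \subset e)]| <= J * s ^ J)%N.
Proof.
move=> s0 es.
have -> : [set A : {set T} | (#|A| < J)%N && (A \subset e)] =
    \bigcup_(j < J) [set A : {set T} | A \subset e & #|A| == j].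
  apply/setP=> A; rewrite inE; apply/andP/bigcupP => [[AJ Ae]|[j _]].
    by exists (Ordinal AJ) => //; rewrite inE Ae eqxx.
  by rewrite inE => /andP[-> /eqP ->].
apply: (@leq_trans (\sum_(j < J) #|[set A : {set T} | A \subset e & #|A| == j]|)).
  elim/big_rec2: _ => [|j m B _ h]; first by rewrite cards0.
  by rewrite cardsU; apply: leq_trans (leq_subr _ _) _; rewrite leq_add2l.
rewrite -[J in (J * _)%N](card_ord J) -sum_nat_const; apply: leq_sum => j _.
rewrite cards_draws; apply: leq_trans (bin_le_exp _ _) _.
apply: (@leq_trans (s ^ j)); last by rewrite leq_pexp2l // ltnW.
by case: (nat_of_ord j) => [|j']; rewrite ?expn0 ?leq_exp2r.
Qed.

(** * Weight of a downset with few edges on small vertex sets *)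

Section SparseKruskalKatona.
Local Open Scope ring_scope.
Variables (T : finType) (R : realFieldType) (a kappa : R).
Variables (F : {set {set T}}) (s J X k t : nat).
Implicit Types (A B I S U e : {set T}) (v : T).
Hypotheses (a01 : 0 <= a <= 1) (k01 : 0 <= kappa <= 1).
Hypotheses (dF : downset F) (Fs : forall e, e \in F -> (#|e| <= s)%N).
Hypotheses (s0 : (0 < s)%N) (t0 : (0 < t)%N).
Hypothesis Ft : forall I, (#|I| <= k)%N -> (#|[set e in F | e \subset I]| <= t)%N.
Hypothesis JXk : (2 * (J + X) <= k)%N.
(** The instance is [kappa = D ^ (L - 1)] with [D = max (1, 4 t J s / k)]; the bound on [#|C|] is
    cleared of its denominator. *)
Hypothesis Hk : forall C : {set {set T}}, (k * #|C| <= 4 * t * J * s)%N ->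
  kappa * #|C|%:R <= wt a (down C).

(** The link [G] of [A] inside [S] is degenerate. For nonempty [U] in [S] its members inside [U]
    correspond to edges of [F'] inside [A :|: U], so by sparseness their sizes sum to at most
    [4 t J s |U| / k] and some vertex has degree at most [4 t J s / k]. Joining [A] to [down G]
    stays inside [F]. *)
Lemma sparse_link_wt_ge (F' : {set {set T}}) A S :
    F' \subset F ->
    (forall S, (2 * #|S| <= k)%N -> (k * #|[set e in F' | e \subset S]| <= 4 * t * #|S|)%N) ->
    (#|A| < J)%N -> (#|S| <= X)%N -> [disjoint A & S] ->
  a ^+ J * kappa * #|[set B in powerset S | A :|: B \in F']|%:R <=
  wt a [set e in F | A \subset e].
Proof.
move=> sF' spF' AJ SX dAS; have [a0 a1] := andP a01; have [k0 k1] := andP k01.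
set G := [set B in powerset S | _].
have GS : G \subset powerset S by apply/subsetP=> B; rewrite inE => /andP[].
have dAG e : e \in down G -> [disjoint A & e].
  case/downP => B /(subsetP GS); rewrite inE => BS eB.
  by apply: disjointWr dAS; apply: subset_trans BS.
have ka1 : kappa * a <= 1 by rewrite -[leRHS]mulr1; apply: ler_pM.
have deg : kappa * a * #|G|%:R <= wt a (down G).
  apply: (@degenerate_wt_ge _ _ a a0 kappa (fun n => k * n <= 4 * t * J * s)%N G S) => //.
  move=> U US U0; apply/exists_inP; apply: contraT => /exists_inPn nU.
  have cU0 : (0 < #|U|)%N by rewrite card_gt0.
  have lt1 v : v \in U ->
      (4 * t * J * s < k * #|[set B in G | (B \subset U) && (v \in B)]|)%N.
    by move=> /nU; rewrite -ltnNge.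
  have : (#|U| * (4 * t * J * s).+1 <=
      k * \sum_(v in U) #|[set B in G | (B \subset U) && (v \in B)]|)%N.
    by rewrite -sum_nat_const big_distrr /=; apply: leq_sum => v /lt1.
  under eq_bigr do rewrite -sum1_card.
  rewrite (exchange_big_dep (fun B => B \in [set B in G | B \subset U])) /=; last first.
    by move=> v B _; rewrite !inE => /and3P[-> -> _].
  move=> h1.
  have h2 : (\sum_(B in [set B in G | B \subset U])
      \sum_(v in U | B \in [set B in G | (B \subset U) && (v \in B)]) 1 <=
      #|[set B in G | B \subset U]| * s)%N.
    rewrite -sum_nat_const; apply: leq_sum => B; rewrite inE => /andP[BG BU].
    apply: (@leq_trans #|B|).
      rewrite -[leqRHS]sum1_card [leqRHS](big_setID U) /=.
      apply: leq_trans (leq_addr _ _); apply: eq_leq; apply: eq_bigl => v.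
      by rewrite in_set BG BU /= inE andbC.
    move: BG; rewrite inE => /andP[_ /(subsetP sF')/Fs].
    by apply: leq_trans; apply: subset_leq_card; apply: subsetUr.
  have h3 : (#|[set B in G | B \subset U]| <= #|[set e in F' | e \subset A :|: U]|)%N.
    rewrite -(@card_in_imset _ _ (fun B => A :|: B)); last first.
      move=> B B' + + E; rewrite in_set => /andP[BG _]; rewrite in_set => /andP[BG' _]; apply/setP=> x.
      have d := dAG B (subsetP (sub_down _) _ BG).
      have d' := dAG B' (subsetP (sub_down _) _ BG').
      case: (boolP (x \in A)) => xA; first by rewrite (disjointFr d xA) (disjointFr d' xA).
      by move/setP/(_ x): E; rewrite !inE (negbTE xA).
    apply: subset_leq_card; apply/subsetP=> _ /imsetP[B + ->].
    by rewrite !inE => /andP[/andP[_ ->] BU]; apply: setUS.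
  have cAU : (#|A :|: U| <= #|A| + #|U|)%N by rewrite cardsU leq_subr.
  have cUS := subset_leq_card US.
  have h4 : (k * #|[set e in F' | e \subset A :|: U]| <= 4 * t * #|A :|: U|)%N.
    by apply: spF'; clear -cAU cUS AJ SX JXk; lia.
  (* Here [U] is nonempty and [A] has at most [J - 1] elements. *)
  have h5 : (#|A :|: U| <= J * #|U|)%N.
    apply: leq_trans cAU _; case: (J) AJ => // J'; rewrite ltnS mulSn addnC leq_add2l.
    by move=> h; apply: leq_trans h _; rewrite leq_pmulr.
  have h6 : (k * (#|[set B in G | B \subset U]| * s) <= 4 * t * (J * #|U|) * s)%N.
    rewrite mulnA leq_mul2r; apply/orP; right.
    apply: (@leq_trans (k * #|[set e in F' | e \subset A :|: U]|)).
      by rewrite leq_mul2l h3 orbT.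
    by apply: leq_trans h4 _; rewrite leq_mul2l h5 orbT.
  have := leq_trans h1 (leq_trans (leq_mul (leqnn k) h2) h6).
  by rewrite mulnS !mulnA; clear -cU0; lia.
have sub : [set A :|: C | C in down G] \subset [set e in F | A \subset e].
  apply/subsetP=> _ /imsetP[C /downP[B BG CB] ->]; rewrite inE subsetUl andbT.
  move: BG; rewrite inE => /andP[_ /(subsetP sF') BF].
  by apply: dF BF _; apply: setUS.
apply: le_trans (wt_sub a0 sub); rewrite wt_imset_setU //.
have aA : a ^+ J <= a ^+ #|A| * a by rewrite -exprSr; apply: ler_wiXn2l.
apply: (@le_trans _ _ (a ^+ #|A| * (kappa * a * #|G|%:R))); last first.
  by apply: ler_wpM2l => //; apply: exprn_ge0.
rewrite mulrA (mulrC kappa) mulrA; apply: ler_wpM2r => //.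
by apply: ler_wpM2r.
Qed.

(* Every edge [e] contains a small [A] such that the rest of [e] lies in a set
   [rich_ext F X i A] of at most [X] vertices, where local sparseness applies. *)
Lemma sparse_wt_ge : ~~ rich F X J set0 ->
  a ^+ J * kappa * (#|F|%:R - t%:R) <= (J * (J * s ^ J))%:R * wt a F.
Proof.
move=> nr; have [a0 a1] := andP a01; have [k0 k1] := andP k01.
have [F' [sF' cF' spF']] := remove_dense_spots t0 Ft.
pose P (p : {set T} * 'I_J) := (#|p.1| < J)%N && (#|rich_ext F X p.2 p.1| <= X)%N.
pose G (p : {set T} * 'I_J) := [set B in powerset (rich_ext F X p.2 p.1) | p.1 :|: B \in F'].
have c1 : (#|F'| <= \sum_(p | P p) #|G p|)%N.
  (* [rich_cover] assigns to each edge of [F'] at least one pair [(A, i)], and for a fixed pair the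
     edge is recovered from [e :\: A]. *)
  apply: (@leq_trans (\sum_(e in F') \sum_(p | P p && ((p.1 \subset e) && (e :\: p.1 \in G p))) 1)).
    rewrite -sum1_card; apply: leq_sum => e eF'; have eF := subsetP sF' _ eF'.
    have [A [i [Ae AJ iJ SX sub]]] := rich_cover dF eF (sub0set e) nr.
    rewrite cards0 add0n in AJ; rewrite (bigD1 (A, Ordinal iJ)) //=.
    rewrite /P /G /= AJ SX Ae !inE /= sub.
    by have -> : A :|: e :\: A = e by rewrite -{1}(setIidPr Ae) setID.
  rewrite (exchange_big_dep P) /=; last by move=> e p _ /andP[].
  apply: leq_sum => p Pp; rewrite sum1dep_card.
  rewrite -(@card_in_imset _ _ (fun e => e :\: p.1)); last first.
    move=> e e'; rewrite in_set => /and3P[_ _ /andP[s1 _]]; rewrite in_set => /and3P[_ _ /andP[s2 _]] E.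
    by rewrite -(setID e p.1) -(setID e' p.1) E (setIidPr s1) (setIidPr s2).
  by apply: subset_leq_card; apply/subsetP=> _ /imsetP[e + ->]; rewrite inE => /and3P[_ _ /andP[]].
have c2 : a ^+ J * kappa * #|F'|%:R <= \sum_(p | P p) wt a [set e in F | p.1 \subset e].
  apply: (@le_trans _ _ (\sum_(p | P p) a ^+ J * kappa * #|G p|%:R)).
    rewrite -mulr_sumr -natr_sum; apply: ler_wpM2l; last by rewrite ler_nat.
    by rewrite mulr_ge0 ?exprn_ge0.
  apply: ler_sum => p /andP[pJ pX]; apply: sparse_link_wt_ge => //.
  rewrite disjoint_sym disjoints_subset; apply/subsetP=> v.
  by rewrite !inE => /andP[].
apply: le_trans (_ : a ^+ J * kappa * #|F'|%:R <= _).
  apply: ler_wpM2l; first by rewrite mulr_ge0 ?exprn_ge0.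
  by rewrite lerBlDr -natrD ler_nat.
apply: le_trans c2 _; rewrite /wt mulr_sumr.
apply: (@le_trans _ _ (\sum_(p | P p) \sum_(e in F | p.1 \subset e) a ^+ #|e|)).
  by apply: ler_sum => p _; rewrite le_eqVlt; apply/orP; left; apply/eqP; apply: eq_bigl => e; rewrite inE.
(* An edge is counted at most once for each subset [A] with fewer than [J] elements and each level
   [i], which gives the factor [J * (J * s ^ J)]. *)
rewrite (exchange_big_dep (fun e => e \in F)) /=; last by move=> p e _ /andP[].
apply: ler_sum => e eF; rewrite sumr_const -[leLHS]mulr_natl.
apply: ler_wpM2r; first exact: exprn_ge0.
rewrite ler_nat.
apply: (@leq_trans #|setX [set A : {set T} | (#|A| < J)%N && (A \subset e)] [set: 'I_J]|).
  apply: subset_leq_card; apply/subsetP=> -[A i]; rewrite !inE /= /P /=.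
  by move=> /andP[/andP[-> _] /andP[_ ->]].
rewrite cardsX cardsT card_ord mulnC leq_mul2l card_small_subsets ?orbT //.
exact: Fs.
Qed.

End SparseKruskalKatona.

(** * The lower bound *)

Lemma card_superset (T : finType) (I : {set T}) k : #|I| <= k <= #|T| ->
  exists2 I' : {set T}, #|I'| = k & I \subset I'.
Proof.
move=> /andP[Ik kT]; have := card_supersets_ge Ik.
case: (set_0Vmem [set I' : {set T} | (#|I'| == k) && (I \subset I')]) => [->|[I' +] _].
  by rewrite cards0 leqNgt bin_gt0 leq_sub2r.
by rewrite inE => /andP[/eqP ? ?]; exists I'.
Qed.

Lemma max_trace_ge n (F : {set {set 'I_n}}) k (I : {set 'I_n}) : #|I| = k ->
  trace_card F I <= max_trace F k.
Proof. by move=> /eqP Ik; rewrite /max_trace (bigD1 I) //= leq_maxl. Qed.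

(** The edges of size exactly [J] supplied by [rich_count] alone carry this weight. *)
Lemma card_rich0 (T : finType) (F : {set {set T}}) X J (R : realFieldType) (a : R) :
  (0 <= a)%R -> rich F X J set0 -> (a ^+ J * X%:R ^+ J <= J`!%:R * wt a F)%R.
Proof.
move=> a0 /rich_count; rewrite cards0 add0n; set E := [set e in F | _] => h.
have sE : E \subset F by apply/subsetP=> e; rewrite inE => /andP[].
have wE : (wt a E = a ^+ J * #|E|%:R)%R.
  rewrite /wt (eq_bigr (fun=> a ^+ J)%R); last first.
    by move=> e; rewrite inE => /and3P[_ _ /eqP ->].
  by rewrite sumr_const -[LHS]mulr_natr.
apply: (@le_trans _ _ (J`!%:R * wt a E)%R); last first.
  by apply: ler_wpM2l; [exact: ler0n | exact: wt_sub].
rewrite wE mulrCA; apply: ler_wpM2l; first exact: exprn_ge0.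
by rewrite -natrX -natrM ler_nat.
Qed.

Lemma fact_le_exp J : J`! <= J ^ J.
Proof.
rewrite -ffactnn; elim: {2 4}J => [//|m IH]; rewrite ffactnSr expnSr.
by rewrite leq_mul // leq_subr.
Qed.

Section RealInstance.
Local Open Scope R_scope.

Lemma Rpower_log2_nat_add (a : R) (x y : nat) : 0 < a <= 1 -> (0 < y <= x)%N ->
  Rpower (INR (x + y)) (log2 (1 + a)) <=
  Rpower (INR x) (log2 (1 + a)) + a * Rpower (INR y) (log2 (1 + a)).
Proof.
move=> Ha /andP[/ssrnat.ltP y0 /ssrnat.leP yx]; rewrite plus_INR; apply: Rpower_add_le => //; split.
  exact: lt_0_INR.
exact: le_INR.
Qed.

(** [wt a (down C)] is at least [|down C| ^ L >= |C| ^ L = |C| ^ (L - 1) |C|], and [L - 1 <= 0]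
    allows [|C|] to be replaced by [D] in the first factor. *)
Lemma down_wt_ge (T : finType) (a D : R) (C : {set {set T}}) :
    0 < a <= 1 -> 1 <= D -> INR #|C| <= D ->
  Rpower D (log2 (1 + a) - 1) * INR #|C| <= wt a (down C).
Proof.
move=> Ha D1 CD; have HL := log2_1p_bounds _ Ha; set L := log2 (1 + a) in HL *.
have a0 : (0 <= a)%R by apply/RleP; case: Ha => /Rlt_le.
case: (posnP #|C|) => [->|C0].
  rewrite Rmult_0_r; apply/RleP; apply: sumr_ge0 => e _; exact: exprn_ge0.
have [B BC] : exists B, B \in C by apply/set0Pn; rewrite -card_gt0.
have d0 : set0 \in down C by apply/downP; exists B => //; apply: sub0set.
have cC : (#|C| <= #|down C|)%N by apply: subset_leq_card; apply: sub_down.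
have C1 : 1 <= INR #|C| by rewrite -INR_1; apply: le_INR; apply/ssrnat.leP.
have := @downset_wt_ge T _ a a0 (fun x => Rpower (INR x) L) (down C).
move=> /(_ _ _ (@downset_down _ C) d0) H.
apply: (Rle_trans _ (Rpower (INR #|down C|) L)); last first.
  apply/RleP; apply: H.
    by rewrite INR_1 /Rpower ln_1 Rmult_0_r exp_0.
  by move=> x y xy; apply/RleP; exact: Rpower_log2_nat_add.
apply: (Rle_trans _ (Rpower (INR #|C|) L)); last first.
  apply: Rle_Rpower_l; first by case: HL => /Rlt_le.
  by split; [apply: Rlt_le_trans C1; exact: Rlt_0_1 | apply: le_INR; apply/ssrnat.leP].
rewrite (_ : Rpower (INR #|C|) L = Rpower (INR #|C|) (L - 1) * INR #|C|); last first.
  rewrite -{3}(Rpower_1 (INR #|C|)); last by apply: Rlt_le_trans C1; exact: Rlt_0_1.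
  by rewrite -Rpower_plus; congr Rpower; ring.
apply: Rmult_le_compat_r; first exact: pos_INR.
apply: Rpower_le_l_neg; first by case: HL => _ ?; lra.
by split=> //; lra.
Qed.

(** Both alternatives compare a lower bound on the weight of the compressed family with the upper
    bound [2 t] from sampling. The first arises when [set0] is [J]-rich, the second from
    [sparse_wt_ge]. *)
Lemma max_trace_dichotomy (n s J k : nat) (a : R) (F : {set {set 'I_n}}) :
    0 < a <= 1 -> (0 < #|F| < 2 ^ s.+1)%N -> (0 < s <= k)%N -> (k <= n)%N ->
    (2 * J <= k)%N ->
    (forall j, (j <= s)%N -> a ^ j <= 2 * (INR (k - s) / INR n) ^ j) ->
  let t := INR (max_trace F k) in
  0 < t /\
  ((a * INR (k %/ 2 - J)) ^ J <= 2 * INR J ^ J * t \/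
   a ^ J * Rpower (Rmax 1 (4 * t * INR J * INR s / INR k)) (log2 (1 + a) - 1)
     * (INR #|F| - t) <= INR J * (INR J * INR s ^ J) * (2 * t)).
Proof.
move=> Ha /andP[F0 F2] /andP[s0 sk] kn Jk hb t.
have [F' [dF' cF' tF']] := compression F.
have F'0 : set0 \in F'.
  have : (0 < #|F'|)%N by rewrite cF'.
  by rewrite card_gt0 => /set0Pn[e eF]; apply: dF' eF _; apply: sub0set.
have F's e : e \in F' -> (#|e| <= s)%N.
  move=> /(downset_card dF'); rewrite cF' => /leq_ltn_trans /(_ F2).
  by rewrite ltn_exp2l.
have tk (I : {set 'I_n}) : (#|I| <= k)%N -> (#|[set e in F' | e \subset I]| <= max_trace F k)%N.
  move=> Ik; have [|I' I'k II'] := @card_superset _ I k; first by rewrite Ik card_ord.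
  apply: leq_trans (max_trace_ge F I'k); apply: leq_trans (tF' I').
  apply: subset_leq_card; apply/subsetP=> e; rewrite !inE => /andP[->] /=.
  by move/subset_trans; apply.
have t0 : (0 < max_trace F k)%N.
  apply: leq_trans (tk set0 _); last by rewrite cards0.
  by rewrite card_gt0; apply/set0Pn; exists set0; rewrite inE F'0 sub0set.
have k0 : (0 < k)%N by apply: leq_trans sk.
split; first by apply: lt_0_INR; apply/ssrnat.ltP.
have a01 : (0 <= a <= 1)%R.
  by case: Ha => /Rlt_le/RleP -> /RleP.
have a0 : (0 <= a)%R by case/andP: a01.
(* By [hb], replacing the sampling density [(k - s) / n] by [a] costs a factor of at most 2. *)
have wF' : wt a F' <= 2 * t.
  have := @wt_le_max_induced _ R F' k s (max_trace F k) k0 sk.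
  rewrite card_ord => /(_ kn F's (fun I Ik => tk I (eq_leq Ik))) h.
  apply: (Rle_trans _ (2 * wt ((k - s)%:R / n%:R)%R F')); last first.
    apply: Rmult_le_compat_l; first by lra.
    by apply/RleP; rewrite /t INRE.
  apply/RleP; rewrite RealsE /wt mulr_sumr; apply: ler_sum => e /F's /hb /RleP.
  by rewrite !RealsE.
case: (boolP (rich F' (k %/ 2 - J) J set0)) => [/(card_rich0 a0)/RleP h|nr]; [left|right].
  have -> : (a * INR (k %/ 2 - J)) ^ J = (a ^+ J * (k %/ 2 - J)%:R ^+ J)%R.
    by rewrite !RealsE exprMn.
  apply: (Rle_trans _ _ _ h); rewrite -RmultE -INRE.
  have h1 : INR J`! <= INR J ^ J.
    by apply/RleP; rewrite !RealsE -natrX ler_nat fact_le_exp.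
  have := Rmult_le_compat _ _ _ _ (pos_INR J`!) _ h1 wF'.
  rewrite (_ : INR J ^ J * (2 * t) = 2 * INR J ^ J * t); last by ring.
  by apply; apply/RleP; apply: sumr_ge0 => e _; exact: exprn_ge0.
set D := Rmax _ _; have D1 : 1 <= D by apply: Rmax_l.
have HL := log2_1p_bounds _ Ha.
have k01 : (0 <= Rpower D (log2 (1 + a) - 1) <= 1)%R.
  apply/andP; split; apply/RleP; first by apply: Rlt_le; apply: Rpower_gt0.
  apply: (Rle_trans _ (Rpower D 0)); first by apply: Rle_Rpower => //; lra.
  by rewrite Rpower_O; [exact: Rle_refl|lra].
(* The subtraction is truncated, so [2 * J <= k] enters here. *)
have JXk : (2 * (J + (k %/ 2 - J)) <= k)%N by lia.
have Hk (C : {set {set 'I_n}}) : (k * #|C| <= 4 * max_trace F k * J * s)%N ->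
    (Rpower D (log2 (1 + a) - 1) * #|C|%:R <= wt a (down C))%R.
  move=> h; apply/RleP; rewrite -RmultE -INRE; apply: down_wt_ge => //.
  apply: Rle_trans (Rmax_r _ _).
  have kR : 0 < INR k by apply: lt_0_INR; apply/ssrnat.ltP.
  apply: (Rmult_le_reg_l (INR k)) => //.
  rewrite (_ : INR k * (4 * t * INR J * INR s / INR k) = 4 * t * INR J * INR s); last by field; lra.
  by apply/RleP; rewrite /t !RealsE -(natrM _ 4) -!natrM ler_nat.
have := @sparse_wt_ge _ R a _ F' s J _ k _ a01 k01 dF' F's s0 t0 tk JXk Hk nr.
move=> /RleP; rewrite cF' -!RmultE -RminusE -!INRE -RpowE => h.
apply: Rle_trans h _; rewrite !mult_INR.
have -> : INR (expn s J) = INR s ^ J by rewrite RpowE !INRE natrX.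
apply: Rmult_le_compat_l => //.
by repeat apply: Rmult_le_pos; try apply: pow_le; exact: pos_INR.
Qed.

Lemma tr_ge n m k x :
    (forall F : {set {set 'I_n}}, #|F| = m -> x <= INR (max_trace F k)) ->
    x <= 2 ^ n -> x <= INR (tr n m k).
Proof.
move=> h h2; rewrite /tr; elim/big_ind: _ => [|u v hu hv|F /eqP].
- by rewrite pow_INR.
- by case: (leqP u v).
exact: h.
Qed.

End RealInstance.

Section LowerBound.
Local Open Scope R_scope.

Lemma tr_lower n r a : 1 <= r -> 0 < a <= 1 -> 1 <= log2 (INR n) ->
    1024 * (r * log2 (INR n)) ^ 2 <= a * INR n ->
  Rpower (INR n) (mu r a) / Rpower (256 * r ^ 2 * log2 (INR n) / a ^ 2) (r + 3) <=
  INR (tr n (rnd (Rpower (INR n) r)) (rnd (a * INR n))).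
Proof.
move=> r1 Ha l1 hl; apply: tr_ge; last exact: (lower_triv n r a).
move=> F cF.
set s := (rnd (r * log2 (INR n))).+1; set J := (rnd r).+1; set k := rnd (a * INR n).
have [] := @max_trace_dichotomy n s J k a F Ha.
- rewrite cF; apply/andP; split; first by apply/ssrnat.ltP; apply: (lower_m_pos n r a).
  have /ssrnat.ltP := lower_m_lt n r a r1 Ha l1 hl.
  by rewrite -/s; congr (_ < _)%N; elim: (s.+1) => // i IH; rewrite expnS -IH /=; lia.
- by rewrite /=; apply/ssrnat.leP; apply: (lower_sk n r a).
- by apply/ssrnat.leP; apply: (lower_kn n r a).
- by apply/ssrnat.leP; apply: (lower_Jk n r a).
- by move=> j /ssrnat.leP; apply: (lower_double n r a).
move=> t0; rewrite cF => H.
apply: (lower_final n r a r1 Ha l1 hl _ (k %/ 2 - J)%N) => //.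
apply/ssrnat.leP; rewrite -/J -/k; lia.
Qed.

Lemma tr_ge1 n m k : (0 < m)%N -> (k <= n)%N -> 1 <= INR (tr n m k).
Proof.
move=> m0 kn; apply: tr_ge; last by apply: pow_R1_Rle; lra.
move=> F cF; rewrite -INR_1; apply: le_INR; apply/ssrnat.leP.
have [|I Ik _] := @card_superset _ (set0 : {set 'I_n}) k; first by rewrite cards0 card_ord.
apply: leq_trans (max_trace_ge F Ik); rewrite /trace_card.
have /card_gt0P[e eF] : (0 < #|F|)%N by rewrite cF.
by rewrite card_gt0; apply/set0Pn; exists (e :&: I); apply/imsetP; exists e.
Qed.

Lemma tr_lower_uniform : exists K : R, 0 < K /\
    forall delta : R, 0 < delta < 1 ->
    exists N : nat, forall n : nat, (N <= n)%coq_nat ->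
    forall r alpha : R, 1 <= r -> 0 < alpha <= 1 ->
      r <= Rpower (INR n) delta -> / alpha <= Rpower (INR n) delta ->
      Rpower (INR n) (mu r alpha * (1 - K * delta))
        <= INR (tr n (rnd (Rpower (INR n) r)) (rnd (alpha * INR n))).
Proof.
exists 48; split; first by lra.
move=> d [d0 d1]; case: (Rle_dec (48 * d) 1) => Kd.
  have [n0 hn0] := log2_eventually d 256 d0.
  exists n0 => n /hn0 hl r a r1 Ha hr ha.
  have d7 : 7 * d <= 1 by lra.
  have [h1 h2] := lower_part1 n d r a d0 d7 r1 Ha hl hr ha.
  by apply: Rle_trans h2 _; apply: tr_lower => //; lra.
(* When [48 * d > 1] the exponent is negative, so the claimed bound is at most 1, and [tr] is at
   least 1. *)
exists 1%N => n n1 r a r1 Ha _ _.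
have N1 : 1 <= INR n by rewrite -INR_1; apply: le_INR.
have [hm _] := mu_bounds r a r1 Ha.
apply: (Rle_trans _ 1).
  apply: (Rle_trans _ (Rpower (INR n) 0)); last by rewrite Rpower_O; lra.
  by apply: Rle_Rpower => //; nra.
have nr : 1 <= Rpower (INR n) r.
  apply: (Rle_trans _ (Rpower (INR n) 0)); first by rewrite Rpower_O; lra.
  by apply: Rle_Rpower => //; lra.
apply: tr_ge1.
  apply/ssrnat.ltP; apply: INR_lt; rewrite /=.
  have [] := rnd_bounds (Rpower (INR n) r); lra.
apply/ssrnat.leP; apply: INR_le; have [] := rnd_bounds (a * INR n); nra.
Qed.

Lemma tr_lower_polylog : forall r c : R, 1 <= r -> 0 < c ->
    exists K' : R, exists N : nat, forall n : nat, (N <= n)%coq_nat ->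
    forall alpha : R, 0 < alpha <= 1 ->
      / alpha <= Rpower (log2 (INR n)) c ->
      Rpower (INR n) (mu r alpha) / Rpower (log2 (INR n)) K'
        <= INR (tr n (rnd (Rpower (INR n) r)) (rnd (alpha * INR n))).
Proof.
move=> r c r1 c0; exists ((2 * c + 2) * (r + 3)).
have e0 : 0 < / (3 + c) by apply: Rinv_0_lt_compat; lra.
have [n0 hn0] := log2_eventually (/ (3 + c)) (1024 * r ^ 2) e0.
exists n0 => n /hn0 hl a Ha ha.
have [h1 h2] := lower_part2 n r c a r1 c0 Ha hl ha.
by apply: Rle_trans h2 _; apply: tr_lower => //; nra.
Qed.

End LowerBound.

(** * Transversal blocks and the upper bound *)

(** Of a set and its complement in [2 * d'] points, at least one has [d'] or more elements. *)
Lemma card_large_subsets d' :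
  2 ^ (2 * d') <= 2 * #|[set S : {set 'I_(2 * d')} | d' <= #|S|]|.
Proof.
set B := [set S | _].
have <- : #|powerset [set: 'I_(2 * d')]| = 2 ^ (2 * d').
  by rewrite card_powerset cardsT card_ord.
have sub : powerset [set: 'I_(2 * d')] \subset B :|: [set ~: S | S in B].
  apply/subsetP=> S _; rewrite in_setU; case: (boolP (S \in B)) => //= h.
  apply/imsetP; exists (~: S); last by rewrite setCK.
  have := cardsC S; rewrite card_ord; move: h; rewrite !inE; lia.
apply: leq_trans (subset_leq_card sub) _; rewrite cardsU.
apply: leq_trans (leq_subr _ _) _; rewrite (mul2n #|B|) -addnn leq_add2l.
exact: leq_imset_card.
Qed.

Section Transversals.
Variables (T : finType) (d' w M : nat).
Let d := 2 * d'.
(** [vtx j x] is vertex [x] of class [j]. A [block] selects one vertex from each class, so it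
    encodes a transversal. *)
Variable vtx : 'I_d -> 'I_w -> T.
Hypothesis vtx_inj : forall j x j' x', vtx j x = vtx j' x' -> j = j' /\ x = x'.
Notation block := {ffun 'I_d -> 'I_w}.
Implicit Types (c : block) (S : {set 'I_d}) (b : {ffun 'I_M -> block}) (I : {set T}).

Definition edge c S := [set vtx j (c j) | j in S].

Definition agree c c' := [set j | c j == c' j].

Lemma mem_edge c S j x : (vtx j x \in edge c S) = (j \in S) && (x == c j).
Proof.
apply/imsetP/andP => [[j' jS /vtx_inj[-> ->]]|[jS /eqP ->]]; first by rewrite jS.
by exists j.
Qed.

Lemma edge_inj c c' S S' : edge c S = edge c' S' -> S = S' /\ S \subset agree c c'.
Proof.
move=> E; have sub c1 c2 S1 S2 : edge c1 S1 = edge c2 S2 -> S1 \subset S2 :&: agree c1 c2.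
  move=> E1; apply/subsetP=> j jS; have : vtx j (c1 j) \in edge c1 S1 by rewrite mem_edge jS /=.
  by rewrite E1 mem_edge !inE.
have := sub _ _ _ _ E; have := sub _ _ _ _ (esym E).
rewrite !subsetI => /andP[s1 _] /andP[s2 ->]; split=> //.
by apply/eqP; rewrite eqEsubset s1 s2.
Qed.

Definition hit c I := [set j | vtx j (c j) \in I].

Lemma edge_trace c S I : edge c S :&: I = edge c (S :&: hit c I).
Proof.
apply/setP=> v; rewrite inE; apply/andP/imsetP => [[/imsetP[j jS ->] h]|[j]].
  by exists j => //; rewrite !inE jS h.
by rewrite !inE => /andP[jS h] ->; rewrite imset_f.
Qed.

Definition block_family b : {set {set T}} :=
  [set edge (b p.1) p.2 | p in setX [set: 'I_M] [set S : {set 'I_d} | d' <= #|S|]].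

(** In coding terms, distinct words have Hamming distance greater than [d / 2]. *)
Definition is_code b :=
  [forall i, forall i', (i != i') ==> (#|agree (b i) (b i')| < d')].

(** An edge determines its places [S], and two blocks sharing it agree on [S], that is in at least
    [d'] places, which a code excludes. *)
Lemma card_block_family b : is_code b ->
  #|block_family b| = M * #|[set S : {set 'I_d} | d' <= #|S|]|.
Proof.
move=> /forallP cb; rewrite /block_family card_in_imset; first by rewrite cardsX cardsT card_ord.
move=> [i S] [i' S']; rewrite !inE /= => dS dS' /edge_inj[<- sub].
congr (_, _); apply/eqP/negPn/negP => ii'.
have /forallP/(_ i')/implyP/(_ ii') := cb i.
by rewrite ltnNge (leq_trans dS (subset_leq_card sub)).
Qed.

(** The trace of a partial transversal of block [i] is a part of that transversal over a subset of
    [hit (b i) I]. *)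
Lemma block_family_trace b I :
  #|[set e :&: I | e in block_family b]| <= \sum_i 2 ^ #|hit (b i) I|.
Proof.
apply: (@leq_trans #|\bigcup_i [set edge (b i) S | S in powerset (hit (b i) I)]|).
  apply: subset_leq_card; apply/subsetP=> _ /imsetP[_ /imsetP[[i S] _ ->] ->].
  apply/bigcupP; exists i => //=; rewrite edge_trace imset_f // inE.
  exact: subsetIr.
apply: leq_trans (card_bigcup_le _ _) _; apply: leq_sum => i _.
by rewrite -card_powerset leq_imset_card.
Qed.

(* Overwriting the places [S] of block [i] arbitrarily is injective on the
   left-hand set, as the old values can be read off block [i']. *)
Lemma card_agree_blocks (i i' : 'I_M) S : i != i' ->
  #|[set b : {ffun 'I_M -> block} | S \subset agree (b i) (b i')]| * w ^ #|S|
    <= #|{ffun 'I_M -> block}|.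
Proof.
move=> ii'; case: (posnP w) => [w0|w0].
  case: (posnP #|S|) => [->|S0]; first by rewrite expn0 muln1 max_card.
  by have -> : w ^ #|S| = 0; [rewrite {1}w0 exp0n | rewrite muln0].
pose x0 := Ordinal w0.
have <- : #|pffun_on x0 S (mem 'I_w)| = w ^ #|S| by rewrite card_pffun_on card_ord.
rewrite -[X in _ * X <= _]cardsE -cardsX.
pose upd (p : {ffun 'I_M -> block} * block) : {ffun 'I_M -> block} :=
  [ffun l => if l == i then [ffun j => if j \in S then p.2 j else p.1 i j] else p.1 l].
rewrite -(@card_in_imset _ _ upd); first exact: max_card.
move=> [b g] [b' g']; rewrite !inE /= => /andP[ag sg] /andP[ag' sg'] E.
have Ei l : l != i -> b l = b' l.
  by move=> li; move/ffunP/(_ l): E; rewrite !ffunE (negbTE li).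
have Eij j : (if j \in S then g j else b i j) = (if j \in S then g' j else b' i j).
  by move/ffunP/(_ i): E; rewrite !ffunE eqxx => /ffunP/(_ j); rewrite !ffunE.
congr (_, _); apply/ffunP.
  move=> l; case: (eqVneq l i) => [->|/Ei //]; apply/ffunP=> j.
  have := Eij j; case: (boolP (j \in S)) => // jS _.
  have := subsetP ag _ jS; have := subsetP ag' _ jS; rewrite !inE => /eqP -> /eqP ->.
  by rewrite Ei // eq_sym.
move=> j; have := Eij j; case: (boolP (j \in S)) => // jS _.
move: sg sg' => /pffun_onP[/supportP s1 _] /pffun_onP[/supportP s2 _].
by rewrite s1 // s2.
Qed.

(** Union bound over two block indices and a set of [d'] places on which they agree; each such event
    has probability at most [w ^ (- d')]. *)
Lemma card_not_code :
  #|[set b : {ffun 'I_M -> block} | ~~ is_code b]| * w ^ d' <= M * M * 2 ^ d * #|{ffun 'I_M -> block}|.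
Proof.
pose Ev (p : 'I_M * 'I_M * {set 'I_d}) :=
  [set b : {ffun 'I_M -> block} | p.2 \subset agree (b p.1.1) (b p.1.2)].
pose Q (p : 'I_M * 'I_M * {set 'I_d}) := (p.1.1 != p.1.2) && (#|p.2| == d').
have sub : [set b | ~~ is_code b] \subset \bigcup_(p | Q p) Ev p.
  apply/subsetP=> b; rewrite inE negb_forall => /existsP[i].
  rewrite negb_forall => /existsP[i']; rewrite negb_imply -leqNgt => /andP[ii' h].
  have [S SA Sd] : exists2 S : {set 'I_d}, S \subset agree (b i) (b i') & #|S| = d'.
    have : 0 < #|[set S : {set 'I_d} | S \subset agree (b i) (b i') & #|S| == d']|.
      by rewrite cards_draws bin_gt0.
    by rewrite card_gt0 => /set0Pn[S]; rewrite inE => /andP[? /eqP ?]; exists S.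
  by apply/bigcupP; exists (i, i', S); rewrite /Q ?inE /= ?ii' ?Sd ?eqxx.
apply: (@leq_trans (\sum_(p | Q p) #|Ev p| * w ^ d')).
  rewrite -big_distrl leq_mul2r; apply/orP; right.
  exact: leq_trans (subset_leq_card sub) (card_bigcup_le _ _).
apply: (@leq_trans (\sum_(p | Q p) #|{ffun 'I_M -> block}|)).
  by apply: leq_sum => p /andP[h /eqP <-]; apply: card_agree_blocks.
rewrite sum_nat_const leq_mul2r; apply/orP; right.
apply: leq_trans (max_card _) _.
by rewrite !card_prod !card_ord -cardsT -powersetT card_powerset cardsT card_ord.
Qed.

Local Open Scope ring_scope.

(** The summand is a product over the classes, so the sum over blocks factors into class sums. The
    arithmetic-geometric mean inequality bounds their product by the power of their average, and the
    class sums add up to at most [(d w + k) / 2]. *)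
Lemma sum_hit_le (I : {set T}) k : (0 < d)%N -> (#|I| <= k)%N ->
  \sum_(c : block) (2 ^ #|hit c I|)%:R / 2 ^+ d <=
  ((d * w + k)%:R / (2 * d)%:R) ^+ d :> R.
Proof.
move=> d0 Ik; pose h j x : R := (1 + (vtx j x \in I)%:R) / 2.
have hE c : (2 ^ #|hit c I|)%:R / 2 ^+ d = \prod_j h j (c j).
  rewrite /h big_split /= prodr_const card_ord exprVn; congr (_ / _).
  rewrite natrX -prodr_const big_mkcond /=; apply: eq_bigr => j _; rewrite inE.
  by case: (_ \in I); rewrite ?addr0.
under eq_bigr do rewrite hE.
rewrite -bigA_distr_bigA /=.
have h0 (j : 'I_d) : 0 <= \sum_x h j x.
  by apply: sumr_ge0 => x _; rewrite divr_ge0 ?addr_ge0 ?ler0n.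
have := @leif_AGM R 'I_d (mem 'I_d) (fun j => \sum_x h j x) (fun j _ => h0 j).
move=> /leif_le; rewrite card_ord => /le_trans; apply.
apply: lerXn2r; rewrite ?nnegrE ?divr_ge0 ?ler0n //; first exact: sumr_ge0.
rewrite natrM invfM mulrA; apply: ler_wpM2r; first by rewrite invr_ge0 ler0n.
have -> : \sum_(j in 'I_d) \sum_x h j x = (d * w + \sum_(j < d) \sum_(x < w) (vtx j x \in I))%:R / 2.
  rewrite natrD natr_sum /h mulrDl mulr_suml.
  under eq_bigr do under eq_bigr do rewrite mulrDl.
  under eq_bigr do rewrite big_split /= sumr_const card_ord.
  rewrite big_split /= sumr_const card_ord; congr (_ + _).
    by rewrite -mulrnA -[LHS]mulr_natl mul1r mulnC.
  by apply: eq_bigr => j _; rewrite natr_sum mulr_suml.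
apply: ler_wpM2r; first by rewrite invr_ge0 ler0n.
rewrite ler_nat leq_add2l; apply: leq_trans Ik.
rewrite pair_bigA /= -big_mkcond /= sum1dep_card.
rewrite -(@card_in_imset _ _ (fun p : 'I_d * 'I_w => vtx p.1 p.2)).
  by apply: subset_leq_card; apply/subsetP=> _ /imsetP[p + ->]; rewrite inE.
by move=> [j x] [j' x'] _ _ /= /vtx_inj[-> ->].
Qed.

End Transversals.

(** * Probabilistic existence of the family *)

Section Existence.
Variables (T : finType) (d' w M k : nat).
Let d := 2 * d'.
Variable vtx : 'I_d -> 'I_w -> T.
Hypothesis vtx_inj : forall j x j' x', vtx j x = vtx j' x' -> j = j' /\ x = x'.
Notation block := {ffun 'I_d -> 'I_w}.
Hypotheses (d0 : 0 < d') (w0 : 0 < w).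

(* Markov's inequality for [prod_i (1 + x_i) >= exp (sum_i x_i / 2)], where
   [x_i = 2 ^ |hit (b i) I| / 2 ^ d] lies in [0, 1]. *)
Lemma card_heavy_le (I : {set T}) : #|I| <= k ->
    ((1 + ((d * w + k)%:R / (2 * d * w)%:R) ^+ d) ^+ M <= exp (8 * #|T|%:R)%R :> R)%R ->
  #|[set b : {ffun 'I_M -> block} | 20 * #|T| * 2 ^ d < \sum_i 2 ^ #|hit vtx (b i) I|]| * 2 ^ (2 * #|T|)
    <= #|{ffun 'I_M -> block}|.
Proof.
move=> Ik hyp; set BI := [set b | _].
have dpos : 0 < d by rewrite muln_gt0.
have two0 : (0 < 2 ^+ d :> R)%R by apply: exprn_gt0; rewrite ltr0n.
pose x (c : block) : R := ((2 ^ #|hit vtx c I|)%:R / 2 ^+ d)%R.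
have x0 c : (0 <= x c)%R by rewrite divr_ge0 ?ler0n ?ltW.
have x1 c : (x c <= 1)%R.
  rewrite ler_pdivrMr // mul1r natrX; apply: ler_weXn2l; first by rewrite ler1n.
  by apply: leq_trans (max_card _) _; rewrite card_ord.
pose y : R := ((d * w + k)%:R / (2 * d * w)%:R)%R.
have cb : (#|{: block}|%:R = (w%:R ^+ d) :> R)%R by rewrite card_ffun !card_ord natrX.
have sx : (\sum_c (1 + x c) <= w%:R ^+ d * (1 + y ^+ d) :> R)%R.
  rewrite big_split /= sumr_const -cb mulrDr mulr1 lerD2l cb.
  apply: le_trans (sum_hit_le vtx_inj dpos Ik) _.
  rewrite -exprMn le_eqVlt; apply/orP; left; apply/eqP; congr (_ ^+ _)%R.
  rewrite /y (natrM _ (2 * d) w) invfM mulrCA [X in (_ = _ * X)%R]mulrCA.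
  by rewrite mulfV ?mulr1 // pnatr_eq0 -lt0n.
have e1 (b : {ffun 'I_M -> block}) : b \in BI ->
    (exp (10 * #|T|%:R)%R <= \prod_i (1 + x (b i)) :> R)%R.
  rewrite inE => h.
  (* Heaviness means that the [x (b i)] sum to at least [20 * #|T|], so their halves sum to at least
     [10 * #|T|]. *)
  apply: (@le_trans _ _ (\prod_i exp (x (b i) / 2)%R)%R); last first.
    apply: ler_prod => i _; apply/andP; split; apply/RleP; first exact: Rlt_le (exp_pos _).
    have := exp_half_le (x (b i)); rewrite !RealsE; apply.
    by split; apply/RleP; rewrite ?RealsE; [exact: x0 | exact: x1].
  rewrite -(big_morph exp exp_plus exp_0); apply/RleP.
  suff : (10 * #|T|%:R <= \sum_i (x (b i) / 2))%R.
    by move/RleP; exact: exp_le_mono.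
  rewrite -!mulr_suml ler_pdivlMr ?ltr0n // ler_pdivlMr // -natr_sum.
  rewrite -natrX; apply: le_trans (_ : (20 * #|T| * 2 ^ d)%:R <= _)%R; last by rewrite ler_nat ltnW.
  rewrite !natrM; apply: ler_wpM2r; first exact: ler0n.
  by rewrite mulrAC -(natrM _ 10 2).
(* Extended to all [b], the sum of products factors as the [M]-th power of a sum over one block,
   which [sx] and [hyp] bound. *)
have sum1 : (#|BI|%:R * exp (10 * #|T|%:R)%R <= #|{ffun 'I_M -> block}|%:R * exp (8 * #|T|%:R)%R :> R)%R.
  apply: (@le_trans _ _ (\sum_(b in BI) \prod_i (1 + x (b i)))%R).
    by rewrite mulr_natl -sumr_const; apply: ler_sum => b /e1.
  apply: (@le_trans _ _ (\sum_(b : {ffun 'I_M -> block}) \prod_i (1 + x (b i)))%R).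
    rewrite [leRHS](bigID (mem BI)) /= lerDl; apply: sumr_ge0 => b _.
    by apply: prodr_ge0 => i _; rewrite addr_ge0 ?ler01 ?x0.
  rewrite -(bigA_distr_bigA (fun _ c => 1 + x c)%R) /= prodr_const card_ord.
  apply: (@le_trans _ _ ((w%:R ^+ d * (1 + y ^+ d)) ^+ M)%R).
    have s0 : (0 <= \sum_c (1 + x c))%R by apply: sumr_ge0 => c _; rewrite addr_ge0 ?ler01 ?x0.
    by apply: lerXn2r => //; rewrite nnegrE // (le_trans s0 sx).
  rewrite exprMn card_ffun card_ord natrX cb; apply: ler_wpM2l; first by rewrite !exprn_ge0.
  exact: hyp.
(* The gain [exp (10 |T|) / exp (8 |T|)] is at least [2 ^ (2 |T|)], enough for a union bound over
   the at most [2 ^ |T|] sets [I]. *)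
have e2 : ((2 ^ (2 * #|T|))%:R <= exp (2 * #|T|%:R)%R :> R)%R.
  rewrite natrX -RpowE; apply/RleP.
  rewrite -natrM -(INRE (2 * #|T|)); elim: (2 * #|T|) => [|i IH]; first by rewrite /= exp_0; exact: Rle_refl.
  rewrite S_INR Rplus_comm exp_plus /=; apply: Rmult_le_compat => //.
  - by apply/RleP; rewrite ler0n.
  - by apply: pow_le; apply/RleP; rewrite ler0n.
  - by have := exp_ineq1_le 1; rewrite -INRE.
rewrite -(ler_nat R) natrM.
apply: (@le_trans _ _ (#|BI|%:R * exp (2 * #|T|%:R)%R)%R).
  by apply: ler_wpM2l => //; exact: ler0n.
have e8 : (0 < exp (8 * #|T|%:R)%R :> R)%R by apply/RltP; exact: exp_pos.
rewrite -(ler_pM2r e8) -mulrA (_ : (exp (2 * #|T|%:R)%R * exp (8 * #|T|%:R)%R)%R = exp (10 * #|T|%:R)%R) //.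
by rewrite -RmultE -exp_plus RplusE -mulrDl -natrD.
Qed.

(** At most half of all [b] fail to be codes, and at most a quarter are heavy on some [I], since
    [2 ^ |T| * 2 ^ (- 2 |T|) <= 1 / 4] for [|T| >= 2]. Some [b] avoids both defects. *)
Lemma exists_sparse_family : 1 < #|T| ->
    2 * (M * M * 2 ^ d) <= w ^ d' ->
    ((1 + ((d * w + k)%:R / (2 * d * w)%:R) ^+ d) ^+ M <= exp (8 * #|T|%:R)%R :> R)%R ->
  exists2 F : {set {set T}}, M * 2 ^ d <= 2 * #|F| &
    forall I : {set T}, #|I| <= k -> #|[set e :&: I | e in F]| <= 20 * #|T| * 2 ^ d.
Proof.
move=> T1 hM hyp.
pose BI (I : {set T}) := [set b : {ffun 'I_M -> block} | 20 * #|T| * 2 ^ d < \sum_i 2 ^ #|hit vtx (b i) I|].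
pose NC := [set b : {ffun 'I_M -> block} | ~~ is_code b].
pose Bad := NC :|: \bigcup_(I : {set T} | #|I| <= k) BI I.
set tot := #|{ffun 'I_M -> block}|.
have tot0 : 0 < tot by rewrite /tot !card_ffun !card_ord !expn_gt0 w0.
have h1 : 2 * #|NC| <= tot.
  have := card_not_code d' w M; rewrite -/d -/NC -/tot => h.
  have wd : 0 < w ^ d' by rewrite expn_gt0 w0.
  rewrite -(leq_pmul2r wd) -mulnA; apply: leq_trans (leq_mul (leqnn 2) h) _.
  by rewrite mulnA mulnC leq_mul2l hM orbT.
have h2 : 4 * #|\bigcup_(I : {set T} | #|I| <= k) BI I| <= tot.
  have p2 : 0 < 2 ^ #|T| by rewrite expn_gt0.
  have s1 : #|\bigcup_(I : {set T} | #|I| <= k) BI I| * 2 ^ (2 * #|T|) <= 2 ^ #|T| * tot.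
    apply: (@leq_trans (\sum_(I : {set T} | #|I| <= k) #|BI I| * 2 ^ (2 * #|T|))).
      by rewrite -big_distrl leq_mul2r card_bigcup_le orbT.
    apply: (@leq_trans (\sum_(I : {set T} | #|I| <= k) tot)).
      by apply: leq_sum => I Ik; apply: card_heavy_le.
    rewrite sum_nat_const leq_mul2r; apply/orP; right.
    by apply: leq_trans (max_card _) _; rewrite -cardsT -powersetT card_powerset cardsT.
  rewrite -(leq_pmul2l p2); apply: leq_trans s1.
  rewrite mulnA mulnC leq_mul2l; apply/orP; right.
  rewrite mul2n -addnn expnD leq_mul2l; apply/orP; right.
  by rewrite -[4]/(2 ^ 2) leq_exp2l.
have [b bG] : exists b, b \notin Bad.
  apply/existsP; apply: contraLR tot0; rewrite negb_exists => /forallP hall.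
  have : tot <= #|Bad|.
    by rewrite /tot -cardsT; apply: subset_leq_card; apply/subsetP=> b _; have := hall b; rewrite negbK.
  have : #|Bad| <= #|NC| + #|\bigcup_(I : {set T} | #|I| <= k) BI I|.
    by rewrite cardsU leq_subr.
  by rewrite -leqNgt; lia.
move: bG; rewrite in_setU negb_or inE negbK => /andP[cb /bigcupP nB].
exists (block_family vtx b).
  rewrite (card_block_family vtx_inj cb) mulnCA leq_mul2l; apply/orP; right.
  exact: card_large_subsets.
move=> I Ik; apply: leq_trans (block_family_trace vtx b I) _.
by rewrite leqNgt; apply/negP => h; apply: nB; exists I; rewrite ?inE.
Qed.

End Existence.

Definition grid_vertex n d w (h : d * w <= n) (j : 'I_d) (x : 'I_w) : 'I_n.
Proof.
apply: (@Ordinal n (j * w + x)); apply: leq_trans h.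
apply: (@leq_trans (j.+1 * w)); first by rewrite mulSn addnC ltn_add2r.
by rewrite leq_mul2r ltn_ord orbT.
Defined.

Lemma grid_vertex_inj n d w (h : d * w <= n) j x j' x' :
  grid_vertex h j x = grid_vertex h j' x' -> j = j' /\ x = x'.
Proof.
move=> /(congr1 val) /= E.
have w0 : 0 < w by apply: leq_ltn_trans (ltn_ord x).
split; apply: val_inj => /=.
  by have := congr1 (divn^~ w) E; rewrite !divnMDl // !divn_small // !addn0.
by have := congr1 (modn^~ w) E; rewrite !modnMDl !modn_small.
Qed.

(** A family with too many edges may be thinned to exactly [m], since traces of a subfamily are no
    larger. *)
Lemma tr_le n m k B (F : {set {set 'I_n}}) : m <= #|F| ->
  (forall I : {set 'I_n}, #|I| = k -> trace_card F I <= B) -> tr n m k <= B.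
Proof.
move=> mF hB.
have [G GF Gm] : exists2 G : {set {set 'I_n}}, G \subset F & #|G| = m.
  have : 0 < #|[set G : {set {set 'I_n}} | G \subset F & #|G| == m]|.
    by rewrite cards_draws bin_gt0.
  by rewrite card_gt0 => /set0Pn[G]; rewrite inE => /andP[? /eqP ?]; exists G.
apply: (@leq_trans (max_trace G k)); last first.
  apply/bigmax_leqP => I /eqP Ik; apply: leq_trans (hB I Ik).
  by apply: subset_leq_card; apply: imsetS.
rewrite /tr -big_filter; set s := filter _ _.
have : G \in s by rewrite mem_filter Gm eqxx mem_index_enum.
elim: s => // H s IH; rewrite inE big_cons geq_min.
by case/orP => [/eqP ->|/IH ->]; rewrite ?leqnn ?orbT.
Qed.

(** * The upper bound on [tr] *)

Section UpperBound.
Local Open Scope R_scope.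

Lemma expn_pow i j : expn i j = Nat.pow i j.
Proof. by elim: j => // j IH; rewrite expnS IH. Qed.

Lemma tr_upper n r a : 1 <= r -> 0 < a <= 1 -> 56 <= log2 (INR n) ->
    r <= sqrt (INR n) / log2 (INR n) ->
  INR (tr n (rnd (Rpower (INR n) r)) (rnd (a * INR n))) <= 20 * 2 ^ 18 * Rpower (INR n) (mu r a).
Proof.
move=> r1 Ha l56 hr; apply: Rle_trans (upper_trace n r a r1 Ha l56).
have := upper_exp n r a r1 Ha l56 hr; have := upper_code n r a r1 Ha l56 hr.
have := upper_m n r a r1 Ha l56; have := upper_dw n r a.
have := upper_w_pos n r a r1 Ha l56 hr.
set d' := (S _ + 8)%coq_nat; set d := (2 * d')%coq_nat; set w := Nat.div n d.
set M := S (rnd (INR n * _)); set k := rnd (a * INR n).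
move=> /ssrnat.ltP w0 /ssrnat.leP dw hm hM hexp.
have d'0 : (0 < d')%N by rewrite /d'; lia.
have /ssrnat.ltP n1 := upper_n n l56.
have [|||||F hF tF] := @exists_sparse_family 'I_n d' w M k (grid_vertex dw) (@grid_vertex_inj _ _ _ dw).
- exact: d'0.
- exact: w0.
- by rewrite card_ord.
- by apply/ssrnat.leP; rewrite !expn_pow; exact: hM.
- by rewrite card_ord; apply/RleP; move: hexp; rewrite !RealsE.
apply: le_INR; apply/ssrnat.leP; apply: tr_le (F) _ _.
  have : (2 * rnd (Rpower (INR n) r) <= 2 * #|F|)%N.
    apply: leq_trans hF; apply/ssrnat.leP; rewrite !expn_pow; exact: hm.
  by rewrite leq_pmul2l.
move=> I Ik; have := tF I; rewrite Ik leqnn card_ord => /(_ isT).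
by rewrite expn_pow.
Qed.

Lemma tr_upper_uniform : exists K'' : R, exists N : nat, forall n : nat, (N <= n)%coq_nat ->
    forall alpha r : R, 0 < alpha <= 1 ->
      1 <= r -> r <= sqrt (INR n) / log2 (INR n) ->
      INR (tr n (rnd (Rpower (INR n) r)) (rnd (alpha * INR n)))
        <= K'' * Rpower (INR n) (mu r alpha).
Proof.
exists (20 * 2 ^ 18); have [n0 hn0] := log2_eventually 1 56 Rlt_0_1.
by exists n0 => n /hn0[l56 _] a r Ha r1 hr; apply: tr_upper.
Qed.

End UpperBound.

End Traces.

Open Scope R_scope.

Theorem theorem1p1 :
  (* (i) lower bound, first part *)
  (exists K : R, 0 < K /\
    forall delta : R, 0 < delta < 1 ->
    exists N : nat, forall n : nat, (N <= n)%nat ->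
    forall r alpha : R, 1 <= r -> 0 < alpha <= 1 ->
      r <= Rpower (INR n) delta -> / alpha <= Rpower (INR n) delta ->
      Rpower (INR n) (mu r alpha * (1 - K * delta))
        <= INR (tr n (rnd (Rpower (INR n) r)) (rnd (alpha * INR n)))) /\
  (* (i) lower bound, second part *)
  (forall r c : R, 1 <= r -> 0 < c ->
    exists K' : R, exists N : nat, forall n : nat, (N <= n)%nat ->
    forall alpha : R, 0 < alpha <= 1 ->
      / alpha <= Rpower (log2 (INR n)) c ->
      Rpower (INR n) (mu r alpha) / Rpower (log2 (INR n)) K'
        <= INR (tr n (rnd (Rpower (INR n) r)) (rnd (alpha * INR n)))) /\
  (* (ii) upper bound *)
  (exists K'' : R, exists N : nat, forall n : nat, (N <= n)%nat ->
    forall alpha r : R, 0 < alpha <= 1 ->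
      1 <= r -> r <= sqrt (INR n) / log2 (INR n) ->
      INR (tr n (rnd (Rpower (INR n) r)) (rnd (alpha * INR n)))
        <= K'' * Rpower (INR n) (mu r alpha)).
Proof.
exact (conj Traces.tr_lower_uniform (conj Traces.tr_lower_polylog Traces.tr_upper_uniform)).
Qed.
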